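(* Let $P$ be the triakis icosahedron, the pentakis dodecahedron, or the deltoidal hexecontahedron, and let $\mathcal T$ be a set of tile designs for $P$ with symmetry group the full icosahedral group $I_h$ (order $120$). Suppose there are $t_{\mathrm{id}}$ tiles, of which $t_f$ have reflectional symmetry, i.e. are fixed under the reflection of the face. Then the number of ways of tiling the faces of $P$ up to full icosahedral symmetry $I_h$ is (in all three cases) $$\frac{1}{120}\left(t_{\mathrm{id}}^{60}+24t_{\mathrm{id}}^{12}+20t_{\mathrm{id}}^{20}+15t_{\mathrm{id}}^{30}+t_{\mathrm{id}}^{30}+24t_{\mathrm{id}}^6+20t_{\mathrm{id}}^{10}+15t_{\mathrm{id}}^{28}t_f^4\right)$$ $$=\frac{1}{120}\left(t_{\mathrm{id}}^{60}+16t_{\mathrm{id}}^{30}+20t_{\mathrm{id}}^{20}+24t_{\mathrm{id}}^{12}+20t_{\mathrm{id}}^{10}+24t_{\mathrm{id}}^6+15t_{\mathrm{id}}^{28}t_f^4\right).$$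
   Context: Tilings. Let $P$ be a polyhedron with set of faces $\mathcal F$ and let $\mathcal A$ be a group of isometries of $P$, acting on $\mathcal F$. A set of tile designs is a finite set $\mathcal T$ together with a group action of $\mathcal A$ on $\mathcal T\times\mathcal F$ lying over the action on $\mathcal F$ (so $A\cdot(T,F)=(T',A\cdot F)$ for some $T'\in\mathcal T$). A tiling is a map $\tau:\mathcal F\to\mathcal T$; $\mathcal A$ acts on tilings by moving graphs: $A\cdot\tau$ is the tiling with $((A\cdot\tau)(A\cdot F),A\cdot F)=A\cdot(\tau(F),F)$ for all $F$. The number of ways of tiling up to $\mathcal A$ is the number of $\mathcal A$-orbits on the set of tilings. The induced symmetry group $G$ of a face $F$ is the group of isometries of $F$ realized by elements of the stabilizer $\mathcal A_F$; for $g\in G$, $t_g$ is the number of $T\in\mathcal T$ with $g\cdot(T,F)=(T,F)$, where $g$ acts via the element of $\mathcal A_F$ inducing it. Since $\mathcal A$ acts transitively on faces, $t_g$ does not depend on the choice of $F$. In particular $t_{\mathrm{id}}=|\mathcal T|$. Polyhedra and group. Let $\phi=(1+\sqrt5)/2$. Here $\mathcal A=I_h$ is the group of order $120$ generated by $R_0=\mathrm{diag}(-1,1,1)$, $R_2=\mathrm{diag}(1,-1,1)$ and $R_1=\frac12\begin{pmatrix}1-\phi&-\phi&-1\\-\phi&1&1-\phi\\-1&1-\phi&\phi\end{pmatrix}$. Each polyhedron below is the convex hull of the $I_h$-orbits of the listed points and has $60$ faces. Triakis icosahedron (dual of the truncated dodecahedron; isosceles triangular faces): $(1,1,1)$ and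 $c(0,1,\phi)$ with $c=(7\sqrt5-5)/10$. Pentakis dodecahedron (dual of the truncated icosahedron; isosceles triangular faces): $(1,1,1)$ and $c(0,1,\phi)$ with $c=(3\sqrt5+27)/38$. Deltoidal hexecontahedron (dual of the rhombicosidodecahedron; kite faces): $(1,0,0)$, $c_1(1,1,1)$ and $c_2(0,1,\phi)$ with $c_1=(\sqrt5+4)/11$, $c_2=\phi/3$. In each case the induced symmetry group of a face is $\langle f\mid f^2=e\rangle$, with $f$ the reflection of the face in its axis of symmetry. *)

(* Defs.v *)
(* R^3 is the space of column vectors 'cV[R]_3, on which a matrix A acts by
   x |-> A *m x. *)
From mathcomp Require Export all_boot all_order all_algebra.
From mathcomp Require Export boolp classical_sets functions cardinality.
From mathcomp Require Export reals convex.

Set Implicit Arguments.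
Unset Strict Implicit.
Unset Printing Implicit Defensive.

Import Order.TTheory GRing.Theory Num.Theory.
Local Open Scope classical_set_scope.
Local Open Scope ring_scope.

Section Geometry.
Variable R : realType.
Implicit Types (u v x p q : 'cV[R]_3) (A B : 'M[R]_3) (P F : set 'cV[R]_3).

Definition vec3 (a b c : R) : 'cV[R]_3 :=
  \col_i [:: a; b; c]`_i.

Definition mat3 (r0 r1 r2 : seq R) : 'M[R]_3 :=
  \matrix_(i, j) (nth [::] [:: r0; r1; r2] i)`_j.

Definition dot u v : R := (u^T *m v) 0 0.

Definition convex_hull (V : set 'cV[R]_3) : set 'cV[R]_3 :=
  smallest (@convex_set R 'cV[R]_3) V.

(* The two-dimensional faces: the intersections of P with a supporting plane
   that contain three affinely independent points. *)
Definition faces P : set (set 'cV[R]_3) :=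
  [set F | exists u (h : R),
     [/\ u != 0,
         forall x, P x -> dot u x <= h,
         F = [set x | P x /\ dot u x = h] &
         exists a b c, [/\ F a, F b, F c &
           forall s t : R, s *: (b - a) + t *: (c - a) = 0 -> s = 0 /\ t = 0]]].

Definition linear_group (G : set 'M[R]_3) : Prop :=
  [/\ G `<=` [set A | A \in unitmx],
      G 1%:M,
      forall A B, G A -> G B -> G (A *m B) &
      forall A, G A -> G (invmx A)].

Definition generated_group (S : set 'M[R]_3) : set 'M[R]_3 :=
  smallest linear_group S.

(* The half-turn about the line pq; on any plane containing p and q it is the
   orthogonal reflection of that plane in the line pq.  When p and q are distinct
   points of a face F this is therefore the reflection of F in the axis pq. *)
Definition line_reflection p q x : 'cV[R]_3 :=
  let proj := p + (dot (x - p) (q - p) / dot (q - p) (q - p)) *: (q - p) in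
  2%:R *: proj - x.

Definition induces_reflection A F : Prop :=
  mulmx A @` F = F /\
  exists p q, [/\ F p, F q, p != q &
                  forall x, F x -> A *m x = line_reflection p q x].

Definition golden : R := (1 + Num.sqrt 5) / 2.

(* Of order 120. *)
Definition I_h : set 'M[R]_3 :=
  let phi := golden in
  let R0 := mat3 [:: -1; 0; 0] [:: 0; 1; 0] [:: 0; 0; 1] in
  let R2 := mat3 [:: 1; 0; 0] [:: 0; -1; 0] [:: 0; 0; 1] in
  let R1 := 2^-1 *: mat3 [:: 1 - phi; - phi; -1]
                         [:: - phi; 1; 1 - phi]
                         [:: -1; 1 - phi; phi] in
  generated_group [set R0; R1; R2].

End Geometry.

Arguments golden : clear implicits.
Arguments I_h : clear implicits.

Inductive solid :=
  TriakisIcosahedron | PentakisDodecahedron | DeltoidalHexecontahedron.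

(* The 60-faced solids are the convex hulls of the I_h-orbits of these points. *)
Definition seeds (R : realType) (s : solid) : set 'cV[R]_3 :=
  let phi := golden R in
  let r5 : R := Num.sqrt 5 in
  match s with
  | TriakisIcosahedron =>
      [set vec3 1 1 1; ((7 * r5 - 5) / 10) *: vec3 0 1 phi]
  | PentakisDodecahedron =>
      [set vec3 1 1 1; ((3 * r5 + 27) / 38) *: vec3 0 1 phi]
  | DeltoidalHexecontahedron =>
      [set vec3 1 0 0; ((r5 + 4) / 11) *: vec3 1 1 1;
           (phi / 3) *: vec3 0 1 phi]
  end.

Arguments seeds : clear implicits.

Definition polyhedron (R : realType) (s : solid) : set 'cV[R]_3 :=
  convex_hull [set x | exists A v, [/\ I_h R A, seeds R s v & x = A *m v]].

Arguments polyhedron : clear implicits.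

(* tile_act is only constrained on the matrices belonging to G; as G consists
   of symmetries of P, tile_over says that A . (T, F) = (T', A . F). *)
Record tile_designs (R : realType) (G : set 'M[R]_3) (P : set 'cV[R]_3)
    (T : finType) := TileDesigns {
  tile_act : 'M[R]_3 -> T * faces P -> T * faces P;
  tile_act1 : forall x, tile_act 1%:M x = x;
  tile_actM : forall A B x, G A -> G B ->
    tile_act (A *m B) x = tile_act A (tile_act B x);
  tile_over : forall A t (F : faces P), G A ->
    val (tile_act A (t, F)).2 = mulmx A @` val F
}.

Section Tilings.
Variables (R : realType) (G : set 'M[R]_3) (P : set 'cV[R]_3) (T : finType).
Variable D : tile_designs G P T.

Definition tiling := faces P -> T.

Definition tiling_graph (tau : tiling) : set (T * faces P) :=
  range (fun F => (tau F, F)).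

Definition tiling_orbit (tau : tiling) : set tiling :=
  [set tau' | exists2 A, G A &
                tiling_graph tau' = tile_act D A @` tiling_graph tau].

Definition tiling_orbits : set (set tiling) := range tiling_orbit.

(* t_g, for the symmetry g of the face F induced by the matrix A. *)
Definition fixed_tiles (A : 'M[R]_3) (F : faces P) : nat :=
  #|[set t : T | `[< tile_act D A (t, F) = (t, F) >]]%SET|.

End Tilings.

(* Main.v *)
Require Import Defs.
From mathcomp Require Import all_fingroup cyclic.
From mathcomp Require Import interval_inference ring lra zify.
Set Implicit Arguments.
Unset Strict Implicit.
Unset Printing Implicit Defensive.
Import Order.TTheory GRing.Theory Num.Theory.

(** The group I_h is the Coxeter group of the icosahedron.  Each of the three
    solids is bounded by the images of a single face under this group, and the
    face has exactly one nontrivial symmetry in it, a mirror reflection; so the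
    tilings can be counted by Burnside's lemma.

    The count (burnside_tilings, card_invariant_tilings).  For a subgroup K, a
    K-invariant tiling is the same as a choice, in each K-orbit of faces, of a
    design at one representative face that is fixed by the stabilizer of that
    face.  When only the conjugates of one reflection fix a face and this
    reflection is no proper power, the group generated by a nonreflection of
    order n acts freely on the 60 faces and fixes t_id ^ (60 / n) tilings.
    Every face is fixed by one of the 15 reflections, so each of these fixes 4
    faces and exchanges the other 56 in pairs: it fixes t_id ^ 28 * t_f ^ 4
    tilings (card_tiling_orbits).

    The group (I_hP, sum_nonreflections).  I_h permutes the twelve vertices of
    an icosahedron, and its elements are recovered from these permutations
    because the vertices form a tight frame.  The orders of the 120 elements
    and the centralizers of the generators are then a finite computation on
    permutations.

    The faces (facesP, facet_stab).  The three generating reflections bound a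
    triangular cone, the chamber.  Every vector can be moved into the chamber
    by I_h.  Its extreme rays are spanned by sums of one, two or three mutually
    adjacent vertices, whence w_k . (A w_l) <= w_k . w_l for A in I_h
    (ray_dominant): an inner product of two distinct vertices is at most that
    of two adjacent ones.  In each of the solids the plane of one face meets the
    three rays at points of the solid, and its normal n is a positive
    combination of two of the w_k.  Dominance shows that n . x is maximal on
    this plane, so it cuts out a face F0, which contains the part of the plane
    lying in the chamber.  For any face, the group can move the barycentre of
    three affinely independent points of the face into the chamber; the ray
    through it then leaves the solid on the plane of F0, and the moved face is
    F0.  An element preserving F0 fixes n, hence by the equality case of
    dominance two of the rays: it is the identity or the reflection in the
    plane spanned by them. *)

(** * Invariant tilings under a finite group *)

Section InvariantTilings.
From mathcomp Require Import fintype finset.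

(** For actions defined on a subgroup only. *)
Lemma astab1_inP (aT : finGroupType) (D : {group aT}) (rT : finType)
    (to : action D rT) x a : a \in D ->
  reflect (to x a = x) (a \in 'C[x | to])%g.
Proof. by move=> Da; rewrite !inE Da sub1set inE; apply: eqP. Qed.

Local Open Scope group_scope.
Variables (gT : finGroupType) (H : {group gT}) (Phi T : finType).
Variables (toP : action H Phi) (toE : action H (T * Phi)%type).
Hypothesis toE_over : forall e a, a \in H -> (toE e a).2 = toP e.2 a.
Implicit Types (tau : {ffun Phi -> T}) (K : {group gT}).

(** Tilings are acted upon through their graphs, which lets the set action
    induced by [toE] serve as the action on tilings. *)
Definition graph_of tau : {set T * Phi} := [set e | tau e.2 == e.1].

Lemma in_graph tau e : (e \in graph_of tau) = (tau e.2 == e.1).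
Proof. by rewrite inE. Qed.

Lemma mem_graph tau x : (tau x, x) \in graph_of tau.
Proof. by rewrite inE. Qed.

Lemma graph_inj : injective graph_of.
Proof.
move=> t1 t2 e; apply/ffunP => x.
by have := mem_graph t1 x; rewrite e inE /= => /eqP.
Qed.

Definition invariant_tilings K := [set tau | K \subset 'C[graph_of tau | toE^*]].

Lemma invariant_tilingsP K tau : K \subset H ->
  reflect {in K, forall a x, toE (tau x, x) a = (tau (toP x a), toP x a)}
          (tau \in invariant_tilings K).
Proof.
move=> sKH; apply: (iffP idP).
  rewrite inE => /subsetP sK a Ka x; have Ha := subsetP sKH a Ka.
  have /(astab1_inP _ _ Ha) stab := sK _ Ka.
  have : toE (tau x, x) a \in graph_of tau.
    by rewrite -stab; apply: imset_f; apply: mem_graph.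
  rewrite inE => /eqP e; have /= e2 := toE_over (tau x, x) Ha.
  by rewrite -e2 e -surjective_pairing.
move=> ptw; rewrite inE; apply/subsetP => a Ka.
have Ha := subsetP sKH a Ka; apply/(astab1_inP _ _ Ha).
apply/eqP; rewrite eqEcard card_imset ?leqnn ?andbT; last exact: act_inj.
apply/subsetP => _ /imsetP[[t x] + ->]; rewrite inE /= => /eqP <-.
by rewrite ptw // mem_graph.
Qed.

Lemma actsT K : K \subset H -> [acts K, on setT | toP].
Proof.
move=> sKH; apply/subsetP => a Ka; rewrite !inE (subsetP sKH) //=.
by apply/subsetP => y; rewrite !inE.
Qed.

Definition fixed_fibre K x := [set t | 'C_K[x | toP] \subset 'C[(t, x) | toE]].

(** An invariant tiling is determined by its values on a transversal of the
    orbits of faces, and a value at a representative face extends to its orbit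
    exactly when the stabilizer of that face fixes it. *)
Lemma card_invariant_tilings K : K \subset H ->
  #|invariant_tilings K| =
    (\prod_(x in orbit_transversal toP K setT) #|fixed_fibre K x|)%N.
Proof.
move=> sKH; set X := orbit_transversal _ _ _.
have [_ _ Xinj Xrep] := orbit_transversalP (actsT sKH).
(* None marks the faces outside the transversal, so that their factors in the
   product formula are 1 even if there are no designs at all. *)
pose restr tau : {ffun Phi -> option T} :=
  [ffun x => if x \in X then Some (tau x) else None].
pose F x : {pred option T} :=
  mem (if x \in X then [set Some t | t in fixed_fibre K x] else [set None]).
have -> : (\prod_(x in X) #|fixed_fibre K x|)%N = #|family F|.
  rewrite card_family foldrE big_map big_enum /= [LHS]big_mkcond /=.
  apply: eq_bigr => x _; rewrite /F; case: ifP => _; last by rewrite cards1.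
  by rewrite card_imset //; apply: Some_inj.
rewrite -(card_in_imset (f := restr)) =>
    [|t1 t2 /(invariant_tilingsP _ sKH) inv1 /(invariant_tilingsP _ sKH) inv2 e].
  apply: eq_card => g; apply/imsetP/familyP => [[tau inv ->] x|gF].
    rewrite /F /restr ffunE; case: ifP => xX; last by rewrite inE.
    apply: imset_f; rewrite inE; apply/subsetP => a; rewrite inE => /andP[Ka].
    have Ha := subsetP sKH a Ka; move=> /(astab1_inP _ _ Ha) stab.
    move/(invariant_tilingsP _ sKH): inv => /(_ a Ka x).
    by rewrite stab => e; apply/(astab1_inP _ _ Ha).
  have /fin_all_exists[h hP] x : exists a, (a \in K) && (toP x a \in X).
    by have [a Ka xa] := Xrep x (in_setT x); exists a; rewrite Ka xa.
  have gX x : x \in X -> exists2 t, g x = Some t & t \in fixed_fibre K x.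
    by move=> xX; have := gF x; rewrite /F xX => /imsetP[t ? ->]; exists t.
  have /fin_all_exists[t tP] x :
      exists t, g (toP x (h x)) = Some t /\ t \in fixed_fibre K (toP x (h x)).
    by have /andP[_ /gX[t gt tf]] := hP x; exists t.
  have Kh x : h x \in K by case/andP: (hP x).
  have Hh x : h x \in H by apply: (subsetP sKH).
  (* The invariant tiling extending g: carry the design at the representative
     of the orbit of x back to x. *)
  pose tau := [ffun x => (toE (t x, toP x (h x)) (h x)^-1).1].
  have tauE x : (tau x, x) = toE (t x, toP x (h x)) (h x)^-1.
    apply: injective_projections; rewrite /= ?ffunE //.
    rewrite toE_over ?groupV //= -actMin ?groupV //.
    by rewrite mulgV act1.
  exists tau.
    apply/(invariant_tilingsP _ sKH) => a Ka x.
    have Ha : a \in H by apply: (subsetP sKH).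
    set y := toP x a.
    have rep : toP x (h x) = toP y (h y).
      apply/eqP; case/andP: (hP x) => _ x1; case/andP: (hP y) => _ y1.
      rewrite -Xinj //; apply/imsetP; exists ((h x)^-1 * (a * h y)).
        by rewrite !groupM ?groupV.
      by rewrite -actMin ?groupM ?groupV // mulKVg actMin.
    have tt : t x = t y.
      by have [e1 _] := tP x; have [e2 _] := tP y; move: e1 e2; rewrite rep => -> [].
    rewrite !tauE tt rep -actMin ?groupV //.
    have -> : (h x)^-1 * a = ((h x)^-1 * a * h y) * (h y)^-1 by rewrite mulgK.
    rewrite actMin ?groupM ?groupV //; congr (toE _ _).
    have [_] := tP y; rewrite inE => /subsetP/(_ ((h x)^-1 * a * h y)) st.
    have Kk : (h x)^-1 * a * h y \in K by rewrite !groupM ?groupV.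
    have Hk := subsetP sKH _ Kk.
    apply/(astab1_inP _ _ Hk)/st; rewrite in_setI Kk /=.
    apply/(astab1_inP _ _ Hk).
    rewrite -{1}rep -actMin // !mulgA mulgV mul1g actMin //.
  apply/ffunP => x; rewrite ffunE; case: ifP => xX; last first.
    by have := gF x; rewrite /F xX inE => /eqP.
  have [gx tf] := tP x.
  have e : toP x (h x) = x.
    apply/eqP; rewrite eq_sym -Xinj //; first by apply: mem_orbit.
    by case/andP: (hP x).
  move: gx tf; rewrite e => -> tf; congr Some.
  move: tf; rewrite inE => /subsetP/(_ (h x)^-1).
  have -> : (h x)^-1 \in 'C_K[x | toP].
    by rewrite groupV inE Kh; apply/(astab1_inP _ _ (Hh x)).
  have Hv : (h x)^-1 \in H by rewrite groupV.
  by move=> /(_ isT)/(astab1_inP _ _ Hv) st; have := tauE x; rewrite e st => -[].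
apply/ffunP => x; have [a Ka xa] := Xrep x (in_setT x).
have /ffunP/(_ (toP x a)) := e; rewrite !ffunE xa => -[e1].
have := inv1 a Ka x; rewrite e1 -(inv2 a Ka x) => /act_inj.
by case.
Qed.

Definition tiling_graphs : {set {set T * Phi}} := [set graph_of tau | tau in setT].

Lemma acts_tiling_graphs : [acts H, on tiling_graphs | toE^*].
Proof.
apply/subsetP => a Ha; rewrite in_setI Ha inE; apply/subsetP => _ /imsetP[tau _ ->].
rewrite inE; apply/imsetP.
have Hv : a^-1 \in H by rewrite groupV.
pose tau' := [ffun x => (toE (tau (toP x a^-1), toP x a^-1) a).1].
exists tau' => //; apply/eqP; rewrite eqEcard; apply/andP; split.
  apply/subsetP => _ /imsetP[[t x] + ->]; rewrite !inE /= => /eqP <-.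
  rewrite toE_over //= ffunE -actMin // mulgV act1.
  by [].
rewrite (card_imset _ (act_inj toE a)).
have card_graph t : #|graph_of t| = #|Phi|.
  rewrite -cardsT -(card_imset setT (f := fun x => (t x, x))); last by move=> x y [].
  apply: eq_card => -[u x]; rewrite inE /=; apply/eqP/imsetP => [<-|[y _ [-> ->]] //].
  by exists x.
by rewrite !card_graph.
Qed.

Definition graph_orbits := [set orbit toE^* H A | A in tiling_graphs].

Lemma burnside_tilings :
  (\sum_(a in H) #|invariant_tilings <[a]>|)%N =
    (#|graph_orbits| * #|H|)%N.
Proof.
rewrite -(Frobenius_Cauchy acts_tiling_graphs); apply: eq_bigr => a Ha.
rewrite -(card_imset _ graph_inj); apply: eq_card => A.
have stabE tau :
    (tau \in invariant_tilings <[a]>) = (toE^* (graph_of tau) a == graph_of tau)%act.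
  by rewrite inE cycle_subG; apply/astab1_inP/eqP.
apply/imsetP/setIP => [[tau + ->]|[/imsetP[tau _ ->]]].
  rewrite stabE => /eqP fixa; split; first exact: imset_f.
  by apply/afixP => _ /set1P ->.
move/afixP => fixa; exists tau => //.
by rewrite stabE; apply/eqP/fixa/set11.
Qed.

Lemma sum_card_orbits K : K \subset H ->
  (\sum_(x in orbit_transversal toP K setT) #|orbit toP K x|)%N = #|Phi|.
Proof.
move=> sKH; have [_ _ Xinj Xrep] := orbit_transversalP (actsT sKH).
rewrite -cardsT -(acts_sum_card_orbit (actsT sKH)).
set X := orbit_transversal _ _ _ in Xinj Xrep *.
have -> : orbit toP K @: setT = orbit toP K @: X.
  apply/setP => O; apply/imsetP/imsetP => [[x _ ->]|[x _ ->]]; last by exists x.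
  have [a Ka xa] := Xrep x (in_setT x); exists (toP x a) => //.
  by apply/esym/orbit_in_eqP => //; apply: mem_orbit.
rewrite [RHS]big_imset // => x y Xx Xy /= e; apply/eqP; rewrite -Xinj // e.
exact: orbit_refl.
Qed.

(** All orbits of a freely acting cyclic group have its order as size. *)
Lemma card_free_tilings a : a \in H ->
    (forall x, 'C_(<[a]>)[x | toP] = 1) ->
  #|invariant_tilings <[a]>| = (#|T| ^ (#|Phi| %/ #[a]))%N.
Proof.
move=> Ha free; have sKH : <[a]> \subset H by rewrite cycle_subG.
rewrite card_invariant_tilings // (eq_bigr (fun=> #|T|)) => [|x _]; last first.
  by rewrite -cardsT; apply: eq_card => t; rewrite !inE free sub1set group1.
rewrite prod_nat_const -(sum_card_orbits sKH) (eq_bigr (fun=> #[a])) => [|x _].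
  by rewrite sum_nat_const mulnK // order_gt0.
by rewrite card_orbit_in // free indexg1.
Qed.

(** In this section, the group is transitive on faces and the stabilizer of a
    face is generated by an involution f that is no proper power, so that the
    conjugates of f are the only elements having powers other than 1 that fix
    a face. *)
Section TwoElementStabilizers.
Variables (x0 : Phi) (f : gT).
Hypothesis transH : forall x, x \in orbit toP H x0.
Hypothesis stab_x0 : 'C_H[x0 | toP] = [set 1; f].
Hypothesis f_neq1 : f != 1.
Hypothesis f_not_power : forall a, a \in H -> f \in <[a]> -> a = f.

Let Hf : f \in H.
Proof. by have /setIP[] : f \in 'C_H[x0 | toP] by rewrite stab_x0 set22. Qed.

Let f2 : #[f] = 2.
Proof.
have sub : <[f]> \subset [set 1; f] by rewrite -stab_x0 cycle_subG /= stab_x0 set22.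
have := subset_leq_card sub; rewrite cards2 eq_sym f_neq1 -orderE.
by have := order_gt1 f; rewrite f_neq1; case: #[f] => [|[|[|]]].
Qed.

Lemma stab_act h : h \in H -> 'C_H[toP x0 h | toP] = [set 1; f ^ h].
Proof.
move=> Hh; rewrite astab1_act_in // -{1}(conjGid Hh) -conjIg stab_x0.
by rewrite /conjugate imsetU1 imset_set1 conj1g.
Qed.

Definition fixed_faces a := #|[set x | toP x a == x]|.

Lemma stab_class a x : a \in H -> a != 1 -> toP x a = x ->
  exists h, [/\ h \in H, a = f ^ h & x = toP x0 h].
Proof.
move=> Ha a1 fix_a; have /orbitP[h Hh xE] := transH x.
have : a \in 'C_H[x | toP] by rewrite in_setI Ha; apply/astab1_inP.
rewrite -xE stab_act // !inE (negPf a1) => /eqP aE.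
by exists h.
Qed.

Lemma fixed_faces_class a : a \in f ^: H -> fixed_faces a = fixed_faces f.
Proof.
case/imsetP => h Hh ->; rewrite /fixed_faces.
rewrite -[RHS](card_imset _ (act_inj toP h)).
apply: eq_card => x; rewrite inE; apply/idP/imsetP => [/eqP fx|[y]].
  exists (toP x h^-1); last by rewrite -actMin ?groupV // mulVg act1.
  rewrite inE -actMin ?groupV //; apply/eqP; apply: (act_inj toP h).
  rewrite -!actMin ?groupM ?groupV // mulVg act1.
  by rewrite -mulgA.
rewrite inE => /eqP fy ->; rewrite -actMin ?groupJ // conjgE !mulgA mulgV mul1g.
by rewrite actMin // fy.
Qed.

(** Every face is fixed by a unique conjugate of f: count in two ways the pairs
    of a conjugate and a face fixed by it. *)
Lemma class_fixed_faces : (#|f ^: H| * fixed_faces f)%N = #|Phi|.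
Proof.
transitivity (\sum_(a in f ^: H) \sum_(x | toP x a == x) 1)%N.
  rewrite -sum_nat_const; apply: eq_bigr => a fa; rewrite sum1_card -(fixed_faces_class fa).
  by apply: eq_card => x; rewrite inE.
rewrite (exchange_big_dep predT) //= -sum1_card; apply: eq_bigr => x _.
have /orbitP[h Hh xE] := transH x.
rewrite -xE (big_pred1 (f ^ h)) // => a /=; apply/andP/eqP => [[/imsetP[k Hk aE] fix_a]|->].
  have Ha : a \in H by rewrite aE groupJ.
  have : a \in 'C_H[toP x0 h | toP].
    by rewrite in_setI Ha; apply/astab1_inP => //; apply/eqP.
  rewrite stab_act // !inE => /orP[/eqP a1|/eqP //].
  by move: f_neq1; rewrite -(conjg_eq1 f k) -aE a1 eqxx.
split; first exact: imset_f.
have : f ^ h \in 'C_H[toP x0 h | toP] by rewrite stab_act // !inE eqxx orbT.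
by rewrite in_setI => /andP[Hfh /(astab1_inP _ _ Hfh)->].
Qed.

(** If a power of a fixes a face, it is a conjugate of f; as f is no proper
    power, a is then this conjugate itself. *)
Lemma card_nonreflection_tilings a : a \in H -> a \notin f ^: H ->
  #|invariant_tilings <[a]>| = (#|T| ^ (#|Phi| %/ #[a]))%N.
Proof.
move=> Ha nfa; apply: card_free_tilings => // x; apply/trivgP/subsetP => b.
rewrite in_setI => /andP[ab]; have sKH : <[a]> \subset H by rewrite cycle_subG.
have Hb := subsetP sKH b ab; move=> /(astab1_inP _ _ Hb) fix_b.
rewrite inE; apply: contraR nfa => b1.
have [h [Hh bE _]] := stab_class Hb b1 fix_b.
have {}ab : f \in <[a ^ h^-1]>.
  by rewrite cycleJ mem_conjgV -bE.
have := f_not_power _ ab; rewrite groupJr ?groupV // => /(_ Ha) fE.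
by apply/imsetP; exists h; rewrite // -fE conjgKV.
Qed.

Lemma card_stab2_faces : (#|Phi| * 2)%N = #|H|.
Proof.
rewrite -(card_orbit_in_stab toP x0 (subxx _)) stab_x0 cards2 eq_sym f_neq1.
by congr (_ * _)%N; rewrite -cardsT; apply: eq_card => x; rewrite inE transH.
Qed.

(** An element carrying one face to another transports the designs fixed by
    the reflection of the former to those of the latter. *)
Lemma card_fixed_designs h : h \in H ->
  #|[set t | toE (t, toP x0 h) (f ^ h) == (t, toP x0 h)]|
    = #|[set t | toE (t, x0) f == (t, x0)]|.
Proof.
move=> Hh; have Hv : h^-1 \in H by rewrite groupV.
have moveE t x k : k \in H -> toE (t, x) k = ((toE (t, x) k).1, toP x k).
  by move=> Hk; rewrite {1}[toE _ _]surjective_pairing toE_over.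
have inj_move : injective (fun t => (toE (t, x0) h).1).
  move=> t u e; suff : toE (t, x0) h = toE (u, x0) h by move/act_inj => [].
  by rewrite moveE // e -moveE.
rewrite -[RHS](card_imset _ inj_move); apply: eq_card => u; rewrite inE.
apply/eqP/imsetP => [fu|[t]].
  exists (toE (u, toP x0 h) h^-1).1; last first.
    have := moveE u (toP x0 h) _ Hv; rewrite -actMin // mulgV act1 => <-.
    by rewrite -actMin // mulVg act1.
  have e := moveE u (toP x0 h) _ Hv; rewrite -actMin // mulgV act1 in e.
  rewrite inE -e; apply/eqP; apply: (act_inj toE h).
  rewrite -!actMin ?groupM // mulVg act1 -{2}fu conjgE.
  by rewrite mulgA.
rewrite inE => /eqP ft ->; rewrite -moveE // -actMin ?groupJ //.
by rewrite conjgE mulKVg actMin // ft.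
Qed.

(** The orbits of a reflection are its fixed faces, each allowing the designs
    fixed by the reflection, and pairs of faces, allowing all designs. *)
Lemma card_reflection_tilings a : a \in f ^: H ->
  let d := fixed_faces f in
  #|invariant_tilings <[a]>| =
    (#|T| ^ ((#|Phi| - d) %/ 2) * #|[set t | toE (t, x0) f == (t, x0)]| ^ d)%N.
Proof.
move=> fa; rewrite -(fixed_faces_class fa) /=.
have [h0 Hh0 aE] := imsetP fa.
have Ha : a \in H by rewrite aE groupJ.
have a1 : a != 1 by rewrite aE conjg_eq1.
have a2 : #[a] = 2 by rewrite aE orderJ.
have sKH : <[a]> \subset H by rewrite cycle_subG.
have cyc : <[a]> = [set 1; a] by apply: cycle2g.
have stabK x : 'C_(<[a]>)[x | toP] = if toP x a == x then <[a]> else 1.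
  case: eqP => [fix_a|nfix].
    by apply/setIidPl; rewrite cycle_subG; apply/astab1_inP.
  apply/trivgP/subsetP => b /setIP[]; rewrite /= cyc => /set2P[-> //|-> //].
  by move/(astab1_inP _ _ Ha)/nfix.
set X := orbit_transversal toP <[a]> setT.
have [_ _ Xinj Xrep] := orbit_transversalP (actsT sKH).
have FX : [set x | toP x a == x] = [set x in X | toP x a == x].
  apply/setP => x; rewrite !inE; case: eqP => [fix_a|]; rewrite ?andbF ?andbT //.
  have [b ab xb] := Xrep x (in_setT x).
  move: xb; have -> // : toP x b = x.
  by move: ab; rewrite /= cyc => /set2P[]->; rewrite ?act1.
pose Y := [set x in X | toP x a != x].
have sumXY : (fixed_faces a + 2 * #|Y|)%N = #|Phi|.
  rewrite -(sum_card_orbits sKH) -/X (bigID (fun x => toP x a == x)) /=.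
  congr (_ + _)%N.
    rewrite /fixed_faces FX -sum1_card.
    rewrite (eq_bigl (fun x => (x \in X) && (toP x a == x))) => [|x]; last by rewrite inE.
    apply: eq_bigr => x /andP[_ fix_a].
    by rewrite card_orbit_in // stabK fix_a indexgg.
  rewrite mulnC -sum_nat_const.
  rewrite (eq_bigl (fun x => (x \in X) && (toP x a != x))) => [|x]; last by rewrite inE.
  apply: eq_bigr => x /andP[_ /negPf nfix].
  by rewrite card_orbit_in // stabK nfix indexg1 -orderE a2.
rewrite -sumXY addKn mulKn // card_invariant_tilings // -/X.
rewrite (bigID (fun x => toP x a == x)) /= mulnC; congr (_ * _)%N.
  rewrite -prod_nat_const; apply: eq_big => [x|x /andP[_ /negPf nfix]].
    by rewrite inE.
  rewrite -cardsT; apply: eq_card => t.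
  by rewrite !inE stabK nfix sub1set group1.
rewrite /fixed_faces FX -prod_nat_const; apply: eq_big => [x|x /andP[_ fix_a]].
  by rewrite inE.
have [h [Hh aE' xE]] := stab_class Ha a1 (eqP fix_a).
rewrite -(card_fixed_designs Hh) -aE' -xE; apply: eq_card => t.
rewrite !inE stabK fix_a cycle_subG.
by apply/astab1_inP/eqP.
Qed.

Theorem card_tiling_orbits :
  let d := fixed_faces f in
  (#|graph_orbits| * #|H|)%N =
    (\sum_(a in H | a \notin f ^: H) #|T| ^ (#|Phi| %/ #[a])
     + #|f ^: H| *
       (#|T| ^ ((#|Phi| - d) %/ 2) * #|[set t | toE (t, x0) f == (t, x0)]| ^ d))%N.
Proof.
rewrite /= -burnside_tilings (bigID (mem (f ^: H))) /= addnC; congr (_ + _)%N.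
  by apply: eq_bigr => a /andP[Ha nfa]; apply: card_nonreflection_tilings.
rewrite -sum_nat_const; apply: eq_big => [a|a /andP[_ fa]].
  rewrite andb_idl // => /imsetP[h Hh ->].
  by rewrite groupJ.
exact: card_reflection_tilings.
Qed.

End TwoElementStabilizers.

(** Passage from graphs of finite functions to plain functions: an orbit of
    graphs is recovered from the set of functions whose graphs it contains, and
    the orbits of graphs are listed by [enum]. *)
Lemma card_function_orbits (orb : (Phi -> T) -> set (Phi -> T)) :
    (forall tau tau' : Phi -> T, orb tau tau' <->
       graph_of [ffun x => tau' x] \in orbit toE^* H (graph_of [ffun x => tau x])) ->
  (range orb #= `I_#|graph_orbits|)%card.
Proof.
move=> orbP; pose gr (tau : Phi -> T) := graph_of [ffun x => tau x].
have grV (tau : {ffun Phi -> T}) : gr (fun x => tau x) = graph_of tau.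
  by congr graph_of; apply/ffunP => x; rewrite ffunE.
pose tilings_of (O : {set {set T * Phi}}) : set (Phi -> T) := fun t => gr t \in O.
have gr_orbit O : O \in graph_orbits -> exists tau : Phi -> T, O = orbit toE^* H (gr tau).
  by case/imsetP => _ /imsetP[tau _ ->] ->; exists (fun x => tau x); rewrite grV.
have orbit_gr (tau : Phi -> T) : orbit toE^* H (gr tau) \in graph_orbits.
  by apply: imset_f; apply: imset_f.
have orbE (tau : Phi -> T) : orb tau = tilings_of (orbit toE^* H (gr tau)).
  by apply: funext => tau'; apply: propext; apply: orbP.
have tilings_of_inj : {in graph_orbits &, injective tilings_of}.
  move=> O1 O2 O1orb O2orb e; have [t1 E1] := gr_orbit _ O1orb.
  have : tilings_of O1 t1 by rewrite E1; apply: orbit_refl.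
  rewrite e E1; have [t2 ->] := gr_orbit _ O2orb => /orbit_in_eqP.
  by move=> /(_ (subxx _)).
have nth_orbit i : (i < #|graph_orbits|)%N ->
    nth set0 (enum graph_orbits) i \in graph_orbits.
  by move=> lti; rewrite -mem_enum mem_nth // -cardE.
have -> : range orb =
    ((tilings_of \o nth set0 (enum graph_orbits)) @` `I_#|graph_orbits|)%classic.
  apply/seteqP; split=> [_ [tau _ <-]|_ [i lti <-]] /=.
    have Otau := orbit_gr tau; rewrite orbE.
    exists (index (orbit toE^* H (gr tau)) (enum graph_orbits)).
      by rewrite /= cardE index_mem mem_enum.
    by rewrite nth_index ?mem_enum.
  have [tau ->] := gr_orbit _ (nth_orbit i lti).
  by exists tau.
apply: inj_card_eq => i k /set_mem ilt /set_mem klt /= e; apply/eqP.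
rewrite -(nth_uniq set0 (s := enum graph_orbits)) ?enum_uniq -?cardE //.
by apply/eqP; apply: tilings_of_inj => //; apply: nth_orbit.
Qed.

End InvariantTilings.

(** * The icosahedral group as a permutation group *)

Section IcosahedralPermutations.
From mathcomp Require Import fintype finset.

(** The action of the three generating reflections on the icosahedron vertices
    in the order of [vertices] below. *)
Definition gen_table : seq (seq nat) :=
  [:: [:: 0; 1; 3; 2; 5; 4; 7; 6; 9; 8; 10; 11];
      [:: 0; 2; 1; 4; 3; 5; 6; 8; 7; 10; 9; 11];
      [:: 1; 0; 2; 3; 6; 7; 4; 5; 8; 9; 11; 10]].

Definition code_comp (c d : seq nat) := [seq nth 0 d i | i <- c].

Definition word_code (w : seq nat) :=
  foldr (fun k c => code_comp (nth [::] gen_table k) c) (iota 0 12) w.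

Definition word_prod (A B : seq (seq nat)) : seq (seq nat) :=
  [seq a ++ b | a <- A, b <- B].

(** One word for each element.  The generators 0 and 1 fix the vertex 0 and
    generate its stabilizer, which is dihedral of order 10 and covered by the
    first two factors.  The prefixes of 21010 move this vertex to six vertices
    on distinct axes, and the power of 012 is the antipodal map. *)
Definition ico_words : seq (seq nat) :=
  word_prod [seq flatten (nseq i [:: 0; 1]) | i <- iota 0 5]
    (word_prod [:: [::]; [:: 0]]
       (word_prod [seq take i [:: 2; 1; 0; 1; 0] | i <- iota 0 6]
          [:: [::]; flatten (nseq 5 [:: 0; 1; 2])]))%N.

Definition ico_codes := [seq word_code w | w <- ico_words].

(** The bound 10 is the largest order of an element of the group. *)
Definition code_order (c : seq nat) :=
  (find (pred1 (iota 0 12)) (traject (code_comp c) c 10)).+1.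

Local Open Scope group_scope.

Definition gen_fun (k : 'I_3) (i : 'I_12) : 'I_12 := inord (nth 0 (nth [::] gen_table k) i).

Lemma gen_funK k : involutive (gen_fun k).
Proof.
by move=> i; apply: val_inj; case: k => -[|[|[]]] //= ?;
   case: i => -[|[|[|[|[|[|[|[|[|[|[|[]]]]]]]]]]]] //= ?; rewrite /gen_fun !inordK.
Qed.

Definition ico_gen k : 'S_12 := perm (inv_inj (@gen_funK k)).

Definition ico_group : {group 'S_12} := <<[set ico_gen k | k : 'I_3]>>%G.

(** The list of values of a permutation, an encoding on which composition
    reduces by computation. *)
Definition code (p : 'S_12) : seq nat := [seq val (p i) | i <- enum 'I_12].
Lemma nth_code p (i : 'I_12) : nth 0 (code p) i = p i.
Proof. by rewrite (nth_map ord0) ?size_enum_ord // nth_ord_enum. Qed.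

Lemma code_inj : injective code.
Proof. by move=> p q e; apply/permP => i; apply: val_inj; rewrite /= -!nth_code e. Qed.

Lemma codeM p q : code (p * q) = code_comp (code p) (code q).
Proof. by rewrite /code /code_comp -map_comp; apply: eq_map => i /=; rewrite permM nth_code. Qed.

Lemma code1 : code 1 = iota 0 12.
Proof. by rewrite /code -val_enum_ord; apply: eq_map => i; rewrite perm1. Qed.

Lemma code_gen k : code (ico_gen k) = nth [::] gen_table k.
Proof.
apply: (@eq_from_nth _ 0%N) => [|i].
  by rewrite size_map size_enum_ord; case: k => -[|[|[]]].
rewrite size_map size_enum_ord => lti.
rewrite (nth_code _ (Ordinal lti)) permE /gen_fun /= inordK //.
by case: k => -[|[|[]]] // ?; case: i lti => [|[|[|[|[|[|[|[|[|[|[|[|?]]]]]]]]]]]].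
Qed.

Lemma mem_gen_table (k : 'I_3) : nth [::] gen_table k \in gen_table.
Proof. by apply: mem_nth; apply: ltn_ord. Qed.

Lemma word_code_group w : all (ltn^~ 3) w ->
  exists2 p, p \in ico_group & code p = word_code w.
Proof.
elim: w => [_|k w IH /= /andP[k3 /IH[p Hp cp]]]; first by exists 1; rewrite ?code1.
exists (ico_gen (Ordinal k3) * p); last by rewrite codeM code_gen cp.
by rewrite groupM // mem_gen //; apply: imset_f.
Qed.

(** The listed permutations are closed under left multiplication by the
    generators, hence exhaust the group. *)
Lemma ico_codesP c : reflect (exists2 p, p \in ico_group & code p = c) (c \in ico_codes).
Proof.
apply: (iffP idP) => [/mapP[w ww ->]|[p Hp <-]].
  apply: word_code_group.
  have /allP : all (all (ltn^~ 3)) ico_words by vm_compute.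
  by apply.
have /gen_prodgP[n [g gP ->]] := Hp.
elim: n g gP {Hp p} => [|n IH] g gP; first by rewrite big_ord0 code1; vm_compute.
rewrite big_ord_recl codeM; have /imsetP[k _ ->] := gP ord0; rewrite code_gen.
have /allP closed :
    all (fun c => all (fun d => code_comp d c \in ico_codes) gen_table) ico_codes.
  by vm_compute.
have /allP := closed _ (IH (fun i => g (lift ord0 i)) (fun i => gP _)); apply.
exact: mem_gen_table.
Qed.

Lemma perm_ico_codes : perm_eq [seq code p | p in ico_group] ico_codes.
Proof.
apply: uniq_perm; first by rewrite map_inj_uniq ?enum_uniq //; apply: code_inj.
  by vm_compute.
move=> c; apply/mapP/ico_codesP => [[p + ->]|[p Hp <-]]; first by rewrite mem_enum; exists p.
by exists p; rewrite ?mem_enum.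
Qed.

Lemma card_ico_group : #|ico_group| = 120%N.
Proof. by rewrite -(size_image code) (perm_size perm_ico_codes). Qed.

Lemma count_ico (P : pred (seq nat)) :
  #|[set p in ico_group | P (code p)]| = count P ico_codes.
Proof.
have /seq.permP <- := perm_ico_codes; rewrite count_map -size_filter cardE /enum_mem.
rewrite -filter_predI; congr (size _); rewrite -enumT.
by apply: eq_filter => p; rewrite !inE andbC.
Qed.

(* order *)
Lemma code_exp p n : code (p ^+ n.+1) = iter n (code_comp (code p)) (code p).
Proof. by elim: n => // n IH; rewrite expgS codeM IH. Qed.

Lemma code_orderE p : p \in ico_group -> #[p] = code_order (code p).
Proof.
move=> Hp; have /allP/(_ (code p)) : all (fun c => code_order c <= 10) ico_codes by vm_compute.
rewrite (introT (ico_codesP _)); last by exists p.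
move=> /(_ isT) le10.
have e n : (p ^+ n.+1 == 1) = (iter n (code_comp (code p)) (code p) == iota 0 12).
  by rewrite -(inj_eq code_inj) code_exp code1.
have has1 : has (pred1 (iota 0 12)) (traject (code_comp (code p)) (code p) 10).
  by rewrite has_find size_traject.
apply/eqP; rewrite eqn_leq; apply/andP; split.
  apply: dvdn_leq => //; rewrite order_dvdn e -(nth_traject _ le10).
  exact: (nth_find (code p) has1).
rewrite leqNgt; apply/negP => lt.
have := order_gt0 p; case o: #[p] lt => [//|m]; rewrite ltnS => lt _.
have lt10 : m < 10 := leq_trans (ltnW lt) le10.
have : (p ^+ m.+1 == 1) = false.
  by rewrite e -(nth_traject _ lt10); exact: (before_find (code p) lt).
rewrite -o.
by rewrite expg_order eqxx.
Qed.

Lemma sum_orders (F : nat -> nat) :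
  (\sum_(p in ico_group) F #[p] =
     F 1 + 31 * F 2 + 20 * F 3 + 24 * F 5 + 20 * F 6 + 24 * F 10)%N.
Proof.
have sum_nseq n m : (\sum_(i <- nseq n m) F i = n * F m)%N.
  by elim: n => [|n IH]; rewrite ?big_nil // big_cons IH mulSn.
transitivity (\sum_(n <- [seq code_order c | c <- ico_codes]) F n)%N.
  rewrite big_map -(perm_big _ perm_ico_codes) /= big_map big_enum /=.
  by apply: eq_bigr => p Hp; rewrite code_orderE.
pose tally := [:: (1, 1); (31, 2); (20, 3); (24, 5); (20, 6); (24, 10)]%N.
have orders : perm_eq [seq code_order c | c <- ico_codes]
    (flatten [seq nseq nd.1 nd.2 | nd <- tally]) by vm_compute.
rewrite (perm_big _ orders) {orders} big_flatten big_map.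
under eq_bigr => nd _ do rewrite sum_nseq.
by rewrite unlock /= mul1n addn0 !addnA.
Qed.

Lemma ico_gen_group k : ico_gen k \in ico_group.
Proof. by apply: mem_gen; apply: imset_f. Qed.

Definition code_commute d c := code_comp c d == code_comp d c.

Lemma code_commuteP p q : reflect (commute p q) (code_commute (code q) (code p)).
Proof. by rewrite /code_commute -!codeM (inj_eq code_inj); apply: eqP. Qed.

(** The centralizer of a reflection is elementary abelian of order 8. *)
Lemma ico_gen_centralizer k p :
  p \in ico_group -> commute p (ico_gen k) -> p * p = 1.
Proof.
move=> Hp /code_commuteP; rewrite code_gen => comm.
have /allP/(_ _ (mem_gen_table k))/allP/(_ (code p)) :
    all (fun d => all (fun c =>
        code_commute d c ==> (code_comp c c == iota 0 12)) ico_codes)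
        gen_table by vm_compute.
rewrite (introT (ico_codesP _)) ?comm => [/(_ isT)/eqP|]; last by exists p.
by rewrite -codeM -code1 => /code_inj.
Qed.

Lemma card_ico_gen_class k : #|ico_gen k ^: ico_group| = 15%N.
Proof.
have card_cent : #|'C_ico_group[ico_gen k]| = 8%N.
  have -> : 'C_ico_group[ico_gen k] =
            [set p in ico_group | code_commute (code (ico_gen k)) (code p)].
    apply/setP => p; rewrite in_setI [in RHS]inE; congr (_ && _).
    by apply/cent1P/code_commuteP => /commute_sym.
  rewrite count_ico code_gen.
  have /allP/(_ _ (mem_gen_table k))/eqP -> // :
    all (fun d => count (code_commute d) ico_codes == 8) gen_table by vm_compute.
by rewrite -index_cent1 -divgS ?subsetIl // card_ico_group /= card_cent.
Qed.

Lemma ico_gen_neq1 k : ico_gen k != 1.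
Proof.
apply/eqP => /(congr1 code); rewrite code_gen code1.
by case: k => -[|[|[]]].
Qed.

(** An element with a reflection as a power commutes with it, so it squares
    to 1 and its only powers are 1 and itself. *)
Lemma ico_gen_not_power k p : p \in ico_group -> ico_gen k \in <[p]> -> p = ico_gen k.
Proof.
move=> Hp gp; have /cycleP[i gE] := gp.
have comm : commute p (ico_gen k) by rewrite gE; apply: commuteX.
have p2 := ico_gen_centralizer Hp comm.
have := ico_gen_neq1 k.
have pE : p ^+ i = if odd i then p else 1.
  rewrite -[in LHS](odd_double_half i) expgD -mul2n expgM expgS expg1 p2 expg1n mulg1.
  by case: (odd i); rewrite ?expg1 ?expg0.
by rewrite gE pE; case: (odd i) => //; rewrite eqxx.
Qed.

Section Reflection.
Variables (k : 'I_3) (q : 'S_12).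
Hypothesis Hq : q \in ico_group.

Lemma card_reflection_class : #|(ico_gen k ^ q) ^: ico_group| = 15%N.
Proof.
have /class_eqP -> : ico_gen k ^ q \in ico_gen k ^: ico_group by apply: imset_f.
exact: card_ico_gen_class.
Qed.

Lemma reflection_not_power p :
  p \in ico_group -> ico_gen k ^ q \in <[p]> -> p = ico_gen k ^ q.
Proof.
move=> Hp gp; apply: (canRL (conjgKV q)); apply: ico_gen_not_power.
  by rewrite groupJ ?groupV.
by rewrite cycleJ mem_conjgV.
Qed.

(** Of the 31 involutions, 15 are reflections. *)
Lemma sum_nonreflections (F : nat -> nat) :
  (\sum_(p in ico_group | p \notin (ico_gen k ^ q) ^: ico_group) F #[p] =
     F 1 + 16 * F 2 + 20 * F 3 + 24 * F 5 + 20 * F 6 + 24 * F 10)%N.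
Proof.
set C := _ ^: _; apply/eqP; rewrite -(eqn_add2l (15 * F 2)); apply/eqP.
have reflE : (15 * F 2 = \sum_(p in ico_group | p \in C) F #[p])%N.
  rewrite -card_reflection_class -/C -sum_nat_const; apply: eq_big => [p|p Cp].
    rewrite andb_idl // => /imsetP[h Hh ->].
    by rewrite !groupJ // ico_gen_group.
  have /imsetP[h _ ->] := Cp; rewrite !orderJ; congr F; apply/esym/eqP.
  rewrite eqn_leq dvdn_leq //= ?order_dvdn; last first.
    by rewrite expgS expg1 (@ico_gen_centralizer k _ (ico_gen_group k)).
  by rewrite order_gt1 ico_gen_neq1.
rewrite [in LHS]reflE; have := sum_orders F; rewrite (bigID (mem C)) /= => ->.
by lia.
Qed.

End Reflection.

End IcosahedralPermutations.

Local Open Scope classical_set_scope.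
Local Open Scope card_scope.
Local Open Scope ring_scope.

(** * Coordinates and the icosahedron *)

Section IcosahedralGeometry.
Variable R : realType.
Implicit Types (x y z u v w a b c : 'cV[R]_3) (p q : 'S_12).
Implicit Types (K S : set 'cV[R]_3).
Local Notation phi := (golden R).

Lemma golden_sq : phi * phi = phi + 1.
Proof.
have s5 : (Num.sqrt 5 * Num.sqrt 5 : R) = 5 by rewrite -expr2 sqr_sqrtr.
by rewrite /golden; move: s5; set s := Num.sqrt 5; lra.
Qed.

Lemma golden_bounds : 8 / 5 < phi < 13 / 8.
Proof.
have s5 : (Num.sqrt 5 * Num.sqrt 5 : R) = 5 by rewrite -expr2 sqr_sqrtr.
have s0 : 0 <= Num.sqrt 5 :> R by apply: sqrtr_ge0.
by rewrite /golden; move: s5 s0; set s := Num.sqrt 5; nra.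
Qed.

Lemma vec3E (a b c : R) i : vec3 a b c i 0 = [:: a; b; c]`_i.
Proof. by rewrite mxE. Qed.

Lemma vec3_eta x : x = vec3 (x 0 0) (x 1 0) (x (2%:R) 0).
Proof.
apply/colP => i; rewrite vec3E.
by case: i => -[|[|[|//]]] lt /=; congr (x _ _); apply: val_inj.
Qed.

Lemma vec3D (a b c a' b' c' : R) :
  vec3 a b c + vec3 a' b' c' = vec3 (a + a') (b + b') (c + c').
Proof. by apply/colP => -[[|[|[|//]]] ?]; rewrite !mxE. Qed.

Lemma vec3Z (t a b c : R) : t *: vec3 a b c = vec3 (t * a) (t * b) (t * c).
Proof. by apply/colP => -[[|[|[|//]]] ?]; rewrite !mxE. Qed.

Lemma vec3N (a b c : R) : - vec3 a b c = vec3 (- a) (- b) (- c).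
Proof. by apply/colP => -[[|[|[|//]]] ?]; rewrite !mxE. Qed.

Lemma dot_vec3 (a b c a' b' c' : R) :
  dot (vec3 a b c) (vec3 a' b' c') = a * a' + b * b' + c * c'.
Proof. by rewrite /dot mxE !big_ord_recr big_ord0 /= add0r !mxE. Qed.

Lemma mat3_mul (a b c d e f g h i x y z : R) :
  mat3 [:: a; b; c] [:: d; e; f] [:: g; h; i] *m vec3 x y z =
    vec3 (a * x + b * y + c * z) (d * x + e * y + f * z) (g * x + h * y + i * z).
Proof.
apply/colP => k; rewrite mxE !big_ord_recr big_ord0 /= add0r !mxE.
by case: k => -[|[|[|//]]].
Qed.

Lemma dotE x y : dot x y = \sum_i x i 0 * y i 0.
Proof. by rewrite /dot mxE; apply: eq_bigr => i _; rewrite mxE. Qed.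

Lemma dotC x y : dot x y = dot y x.
Proof. by rewrite !dotE; apply: eq_bigr => i _; rewrite mulrC. Qed.

Lemma dotDr x y z : dot x (y + z) = dot x y + dot x z.
Proof. by rewrite /dot mulmxDr mxE. Qed.

Lemma dotZr t x y : dot x (t *: y) = t * dot x y.
Proof. by rewrite /dot -scalemxAr mxE. Qed.

Lemma dotBr x y z : dot x (y - z) = dot x y - dot x z.
Proof. by rewrite -scaleN1r dotDr dotZr mulN1r. Qed.

Lemma dot0r x : dot x 0 = 0.
Proof. by rewrite /dot mulmx0 mxE. Qed.

Lemma dot_sumr (I : finType) (Q : pred I) x (F : I -> 'cV[R]_3) :
  dot x (\sum_(i | Q i) F i) = \sum_(i | Q i) dot x (F i).
Proof. by rewrite /dot mulmx_sumr summxE. Qed.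

Lemma dotZl t x y : dot (t *: y) x = t * dot y x.
Proof. by rewrite dotC dotZr (dotC x). Qed.

Lemma dotBl x y z : dot (y - z) x = dot y x - dot z x.
Proof. by rewrite dotC dotBr !(dotC x). Qed.

Lemma dot_suml (I : finType) (Q : pred I) x (F : I -> 'cV[R]_3) :
  dot (\sum_(i | Q i) F i) x = \sum_(i | Q i) dot (F i) x.
Proof. by rewrite dotC dot_sumr; apply: eq_bigr => i _; rewrite dotC. Qed.

Lemma dot_self_eq0 x : dot x x = 0 -> x = 0.
Proof.
move=> xx; apply/colP => i; rewrite mxE; move: xx; rewrite dotE => /eqP.
rewrite psumr_eq0 => [|j _]; last by rewrite -expr2 sqr_ge0.
by move=> /allP/(_ i (mem_index_enum _)); rewrite /= mulf_eq0 orbb => /eqP.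
Qed.

Definition vertices : seq 'cV[R]_3 :=
  [:: vec3 0 (-1) phi; vec3 0 1 phi; vec3 (- phi) 0 1; vec3 phi 0 1;
      vec3 (-1) (- phi) 0; vec3 1 (- phi) 0; vec3 (-1) phi 0; vec3 1 phi 0;
      vec3 (- phi) 0 (-1); vec3 phi 0 (-1); vec3 0 (-1) (- phi); vec3 0 1 (- phi)].

Definition vertex (i : 'I_12) := vertices`_i.

Definition mirrors : seq 'M[R]_3 :=
  [:: mat3 [:: -1; 0; 0] [:: 0; 1; 0] [:: 0; 0; 1];
      2^-1 *: mat3 [:: 1 - phi; - phi; -1]
                   [:: - phi; 1; 1 - phi]
                   [:: -1; 1 - phi; phi];
      mat3 [:: 1; 0; 0] [:: 0; -1; 0] [:: 0; 0; 1]].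

Definition mirror (k : 'I_3) := mirrors`_k.

(** The unit normals of the three mirrors, pointing into the chamber. *)
Definition roots : seq 'cV[R]_3 :=
  [:: vec3 (-1) 0 0; 2^-1 *: vec3 phi 1 (phi - 1); vec3 0 (-1) 0].

Definition root (k : 'I_3) := roots`_k.

Lemma mirrorE k x : mirror k *m x = x - 2 * dot (root k) x *: root k.
Proof.
have phi2 := golden_sq; rewrite (vec3_eta x).
set a := x _ _; set b := x _ _; set c := x _ _.
have pa : phi * phi * a = (phi + 1) * a by rewrite phi2.
have pb : phi * phi * b = (phi + 1) * b by rewrite phi2.
have pc : phi * phi * c = (phi + 1) * c by rewrite phi2.
case: k => -[|[|[|//]]] lt; rewrite /mirror /root /=;
  rewrite -?scalemxAl mat3_mul !vec3Z dot_vec3 ?vec3Z vec3N vec3D;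
  congr vec3; lra.
Qed.

Lemma mirror_vertex k i : mirror k *m vertex i = vertex (ico_gen k i).
Proof.
have phi2 := golden_sq; rewrite permE /vertex /mirror /gen_fun.
case: k => -[|[|[|//]]] lt; case: i => -[|[|[|[|[|[|[|[|[|[|[|[|//]]]]]]]]]]]] lt' /=;
  rewrite inordK //= -?scalemxAl mat3_mul ?vec3Z; congr vec3; lra.
Qed.

Lemma dot_vertex i j : dot (vertex i) (vertex j) <= phi + 2 * (i == j)%:R.
Proof.
have phi2 := golden_sq; have := golden_bounds.
case: i => -[|[|[|[|[|[|[|[|[|[|[|[|//]]]]]]]]]]]] lt';
case: j => -[|[|[|[|[|[|[|[|[|[|[|[|//]]]]]]]]]]]] lt /=;
  rewrite /vertex /= dot_vec3 ?mulr1n ?mulr0n; nra.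
Qed.

Lemma vertex_norm i : dot (vertex i) (vertex i) = phi + 2.
Proof.
have phi2 := golden_sq.
by case: i => -[|[|[|[|[|[|[|[|[|[|[|[|//]]]]]]]]]]]] lt';
  rewrite /vertex /= dot_vec3; lra.
Qed.

Lemma vertex_frame x :
  \sum_i dot (vertex i) x *: vertex i = (4 * phi + 8) *: x.
Proof.
have phi2 := golden_sq; rewrite (vec3_eta x).
set a := x _ _; set b := x _ _; set c := x _ _.
have pa : phi * phi * a = (phi + 1) * a by rewrite phi2.
have pb : phi * phi * b = (phi + 1) * b by rewrite phi2.
have pc : phi * phi * c = (phi + 1) * c by rewrite phi2.
rewrite !big_ord_recr big_ord0 /= add0r /vertex /=.
rewrite !dot_vec3 !vec3Z !vec3D; congr vec3; lra.
Qed.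

(** * The isometry induced by a permutation of the vertices *)

Lemma frame_neq0 : 4 * phi + 8 != 0 :> R.
Proof. by have := golden_bounds; move=> /andP[? ?]; lra. Qed.

Lemma vertex_span x : x = (4 * phi + 8)^-1 *: \sum_i dot (vertex i) x *: vertex i.
Proof. by rewrite vertex_frame scalerA mulVf ?scale1r // frame_neq0. Qed.

(** By the frame identity, the only linear map that can induce p on the
    vertices. *)
Definition isometry p : 'M[R]_3 :=
  (4 * phi + 8)^-1 *: \sum_i vertex (p i) *m (vertex i)^T.

Lemma isometryE p x :
  isometry p *m x = (4 * phi + 8)^-1 *: \sum_i dot (vertex i) x *: vertex (p i).
Proof.
rewrite -scalemxAl mulmx_suml; congr (_ *: _); apply: eq_bigr => i _.
by rewrite -mulmxA [_ *m x]mx11_scalar mul_mx_scalar.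
Qed.

Lemma mulmx_inj m (A B : 'M[R]_(m, 3)) : (forall x, A *m x = B *m x) -> A = B.
Proof.
move=> e; apply/trmx_inj/row_matrixP => i; rewrite !rowE.
by apply: trmx_inj; rewrite !trmx_mul !trmxK e.
Qed.

Lemma isometry_unique p (A : 'M[R]_3) :
  (forall i, A *m vertex i = vertex (p i)) -> isometry p = A.
Proof.
move=> Av; apply: mulmx_inj => x; rewrite isometryE [in RHS](vertex_span x).
rewrite -scalemxAr mulmx_sumr; congr (_ *: _); apply: eq_bigr => i _.
by rewrite -scalemxAr Av.
Qed.

Lemma isometry1 : isometry 1%g = 1%:M.
Proof. by apply: isometry_unique => i; rewrite mul1mx perm1. Qed.

Lemma isometry_gen k : isometry (ico_gen k) = mirror k.
Proof. by apply: isometry_unique => i; rewrite mirror_vertex. Qed.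

Lemma I_h_mul (A B : 'M[R]_3) : I_h R A -> I_h R B -> I_h R (A *m B).
Proof. by move=> hA hB G GG; case: (GG) => -[_ _ GM _] _; apply: GM; [apply: hA|apply: hB]. Qed.

Lemma I_h_mirror k : I_h R (mirror k).
Proof.
apply: sub_gen_smallest; rewrite /mirror.
by case: k => -[|[|[|//]]] lt /=; [left; left|left; right|right].
Qed.

Lemma I_h1 : I_h R 1%:M.
Proof. by move=> G [[]]. Qed.

Lemma ico_groupP p : p \in ico_group ->
  I_h R (isometry p) /\ forall i, isometry p *m vertex i = vertex (p i).
Proof.
move=> Hp; suff [A IA Av] : exists2 A, I_h R A & forall i, A *m vertex i = vertex (p i).
  by rewrite (isometry_unique Av).
have /gen_prodgP[n [g gP ->]] := Hp.
elim: n g gP {Hp p} => [|n IH] g gP.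
  by exists 1%:M => [|i]; [apply: I_h1|rewrite big_ord0 mul1mx perm1].
have [A IA Av] := IH (fun i => g (lift ord0 i)) (fun i => gP _).
have /imsetP[k _ gE] := gP ord0; exists (A *m mirror k) => [|i].
  exact: I_h_mul IA (I_h_mirror k).
by rewrite big_ord_recl gE permM -mulmxA mirror_vertex Av.
Qed.

Lemma isometry_vertex p i : p \in ico_group -> isometry p *m vertex i = vertex (p i).
Proof. by case/ico_groupP. Qed.

(** Permutations compose from left to right, matrices from right to left. *)
Lemma isometryM p q : p \in ico_group -> q \in ico_group ->
  isometry (p * q)%g = isometry q *m isometry p.
Proof.
move=> Hp Hq; apply: isometry_unique => i.
by rewrite -mulmxA !isometry_vertex // permM.
Qed.

(** Reindexing the defining sum by p exchanges the roles of the two factors. *)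
Lemma isometry_tr p : (isometry p)^T = isometry p^-1%g.
Proof.
rewrite /isometry linearZ /= linear_sum /=; congr (_ *: _).
rewrite (reindex_inj (@perm_inj _ p^-1%g)) /=; apply: eq_bigr => i _.
by rewrite trmx_mul trmxK permKV.
Qed.

Lemma dot_isometry p x y : p \in ico_group ->
  dot (isometry p *m x) (isometry p *m y) = dot x y.
Proof.
move=> Hp; rewrite /dot trmx_mul -mulmxA [_^T *m (_ *m y)]mulmxA isometry_tr.
by rewrite -isometryM ?groupV // mulgV isometry1 mul1mx.
Qed.

Lemma isometryKV p x : p \in ico_group -> isometry p *m (isometry p^-1 *m x) = x.
Proof. by move=> Hp; rewrite mulmxA -isometryM ?groupV // mulVg isometry1 mul1mx. Qed.

Lemma isometryK p x : p \in ico_group -> isometry p^-1 *m (isometry p *m x) = x.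
Proof. by move=> Hp; rewrite mulmxA -isometryM ?groupV // mulgV isometry1 mul1mx. Qed.

Lemma vertex_inj : injective vertex.
Proof.
move=> i j e; apply/eqP; have := dot_vertex i j; rewrite -e vertex_norm.
by case: eqP => // _; have /andP[? ?] := golden_bounds; rewrite mulr0 addr0; lra.
Qed.

Lemma isometry_inj : {in ico_group &, injective isometry}.
Proof.
move=> p q Hp Hq e; apply/permP => i; apply: vertex_inj.
by rewrite -!isometry_vertex // e.
Qed.

Lemma isometry_unit p : p \in ico_group -> isometry p \in unitmx.
Proof.
move=> Hp; apply: (proj1 (mulmx1_unit (B := isometry p^-1) _)).
by apply: mulmx_inj => x; rewrite mul1mx -mulmxA isometryKV.
Qed.

Lemma invmx_isometry p : p \in ico_group -> invmx (isometry p) = isometry p^-1.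
Proof.
move=> Hp; apply: mulmx_inj => x; rewrite -{1}(isometryKV x Hp).
by rewrite mulKmx ?isometry_unit.
Qed.

Lemma I_hP (A : 'M[R]_3) : I_h R A <-> exists2 p, p \in ico_group & A = isometry p.
Proof.
split=> [|[p Hp ->]]; last by case: (ico_groupP Hp).
move: A; apply: smallest_sub.
  split.
  - by move=> _ [p Hp ->]; apply: isometry_unit.
  - by exists 1%g; rewrite ?isometry1.
  - move=> _ _ [p Hp ->] [q Hq ->]; exists (q * p)%g; first exact: groupM.
    by rewrite isometryM.
  - move=> _ [p Hp ->]; exists p^-1%g; first by rewrite groupV.
    exact: invmx_isometry.
move=> A; have gen k : exists2 p, p \in ico_group & mirror k = isometry p.
  by exists (ico_gen k); [apply: ico_gen_group|rewrite isometry_gen].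
case=> [[->|->]|->]; [exact: (gen 0)|exact: (gen 1)|].
have := gen (inord 2); rewrite /mirror /= inordK //.
Qed.

(** * The chamber *)

(** The edge of the chamber lying on all mirrors but the k-th: the sum of the
    first 3 - k vertices, which are mutually adjacent. *)
Definition ray (k : 'I_3) : 'cV[R]_3 := \sum_(i < 12 | (i + k <= 2)%N) vertex i.

Definition rays : seq 'cV[R]_3 :=
  [:: vec3 (- phi) 0 (2 * phi + 1); vec3 0 0 (2 * phi); vec3 0 (-1) phi].

Lemma rayE k : ray k = rays`_k.
Proof.
rewrite /ray big_mkcond !big_ord_recr big_ord0 /= /vertex /=.
by case: k => -[|[|[|//]]] lt /=; rewrite ?add0r ?addr0 ?vec3D //; congr vec3; lra.
Qed.

Definition ray_height (k : 'I_3) : R := [:: phi; 1; 1]`_k.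

Lemma ray_height_gt0 k : 0 < ray_height k.
Proof.
have /andP[? ?] := golden_bounds.
by rewrite /ray_height; case: k => -[|[|[|//]]] lt /=; lra.
Qed.

Lemma dot_root_ray k l : dot (root k) (ray l) = ray_height k * (k == l)%:R.
Proof.
have phi2 := golden_sq; rewrite rayE /root /ray_height.
by case: k => -[|[|[|//]]] lt; case: l => -[|[|[|//]]] lt';
  rewrite /= ?vec3Z dot_vec3 ?mulr1n ?mulr0n; lra.
Qed.

Lemma ray_coords x : x = \sum_k (dot (root k) x / ray_height k) *: ray k.
Proof.
have phi2 := golden_sq; have /andP[? ?] := golden_bounds.
have phi0 : phi != 0 by lra.
rewrite {1}(vec3_eta x) [in RHS](vec3_eta x).
set a := x _ _; set b := x _ _; set c := x _ _.
rewrite !big_ord_recr big_ord0 /= add0r !rayE /rays /root /ray_height /=.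
rewrite !vec3Z !dot_vec3 ?vec3Z !vec3D !divr1.
have e : a / phi * phi = a by rewrite divfK.
have e' : a / phi * phi * phi = a * phi by rewrite divfK.
have pa : phi * phi * a = (phi + 1) * a by rewrite phi2.
have pb : phi * phi * b = (phi + 1) * b by rewrite phi2.
have pc : phi * phi * c = (phi + 1) * c by rewrite phi2.
have e2 : a / phi = a * phi - a by apply: (mulIf phi0); rewrite divfK //; lra.
by congr vec3; rewrite ?mulNr ?mulN1r ?mul0r; lra.
Qed.

(** A permutation produces at most as many coincidences between two sets as
    the size of the smaller one, and the identity achieves this when the sets
    are nested. *)
Lemma coincidences_max (P Q : pred 'I_12) p :
    (forall i, P i -> Q i) \/ (forall i, Q i -> P i) ->
  (\sum_(i | P i) \sum_(j | Q j) (i == p j) <=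
   \sum_(i | P i) \sum_(j | Q j) (i == j))%N.
Proof.
have sum_eq (a : 'I_12) : (\sum_(j | Q j) (a == j) = Q a)%N.
  rewrite big_mkcond (bigD1 a) //= eqxx big1 ?addn0 => [|j /negPf ja].
    by case: (Q a).
  by rewrite eq_sym ja if_same.
have sum_perm i : (\sum_(j | Q j) (i == p j) = Q (p^-1%g i))%N.
  by rewrite -sum_eq; apply: eq_bigr => j _; rewrite -(inj_eq (@perm_inj _ p) _ j) permKV.
rewrite (eq_bigr _ (fun i _ => sum_perm i)) (eq_bigr _ (fun i _ => sum_eq i)).
case=> [PQ|QP]; first by apply: leq_sum => i /PQ ->; apply: leq_b1.
rewrite [leqRHS](_ : _ = \sum_i Q i)%N; last first.
  by rewrite big_mkcond; apply: eq_bigr => i _; case: ifP => // /(contraFF (QP i)) ->.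
rewrite [leqRHS](reindex_inj (@perm_inj _ p^-1%g)) /= big_mkcond.
by apply: leq_sum => i _; case: ifP.
Qed.

Lemma dot_first_vertices (i j : 'I_12) : (i <= 2)%N -> (j <= 2)%N ->
  dot (vertex i) (vertex j) = phi + 2 * (i == j)%:R.
Proof.
have phi2 := golden_sq.
by case: i => -[|[|[|//]]] lt' _; case: j => -[|[|[|//]]] lt _;
  rewrite /vertex /= dot_vec3 ?mulr1n ?mulr0n; lra.
Qed.

(** Both sides are sums of inner products of vertices, which are at most phi
    except for coincidences; on the right-hand side all the noncoinciding pairs
    attain phi, and there are as many coincidences as possible. *)
Lemma ray_dominant p k l : p \in ico_group ->
  dot (ray k) (isometry p *m ray l) <= dot (ray k) (ray l).
Proof.
move=> Hp; have dot_rays q : q \in ico_group -> dot (ray k) (isometry q *m ray l) =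
    \sum_(i < 12 | (i + k <= 2)%N) \sum_(j < 12 | (j + l <= 2)%N)
      dot (vertex i) (vertex (q j)).
  move=> Hq; rewrite mulmx_sumr dot_suml; apply: eq_bigr => i _.
  by rewrite dot_sumr; apply: eq_bigr => j _; rewrite isometry_vertex.
pose J k := [pred i : 'I_12 | (i + k <= 2)%N].
have split_sum (F : 'I_12 -> 'I_12 -> bool) :
    \sum_(i in J k) \sum_(j in J l) (phi + 2 * (F i j)%:R) =
    \sum_(i in J k) \sum_(j in J l) phi +
    2 * (\sum_(i in J k) \sum_(j in J l) F i j)%N%:R :> R.
  rewrite natr_sum mulr_sumr -big_split /=; apply: eq_bigr => i _.
  by rewrite natr_sum mulr_sumr -big_split.
have le2 (i : 'I_12) (k' : 'I_3) : i \in J k' -> (i <= 2)%N.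
  by rewrite inE; apply: leq_trans; apply: leq_addr.
have -> : dot (ray k) (ray l) =
    \sum_(i in J k) \sum_(j in J l) (phi + 2 * (i == j)%:R).
  rewrite -[ray l]mul1mx -(isometry1) dot_rays ?group1 //.
  apply: eq_bigr => i /le2 i2; apply: eq_bigr => j /le2 j2.
  by rewrite perm1 dot_first_vertices.
apply: (@le_trans _ _ (\sum_(i in J k) \sum_(j in J l) (phi + 2 * (i == p j)%:R))).
  rewrite dot_rays //; apply: ler_sum => i _; apply: ler_sum => j _.
  exact: dot_vertex.
rewrite !split_sum lerD2l ler_pM2l // ler_nat; apply: coincidences_max.
case: (leqP k l) => [kl|/ltnW lk]; [right|left] => i; rewrite !inE;
  by apply: leq_trans; rewrite leq_add2l.
Qed.

Lemma dot_ray_gt0 k l : 0 < dot (ray k) (ray l).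
Proof.
have phi2 := golden_sq; have /andP[? ?] := golden_bounds; rewrite !rayE.
by case: k => -[|[|[|//]]] lt; case: l => -[|[|[|//]]] lt'; rewrite /= dot_vec3; nra.
Qed.

Definition in_chamber x := forall k, 0 <= dot (root k) x.

(** Among the images of x, take one with the largest inner product with a vector
    in the interior of the chamber: reflecting it in a mirror that separates it
    from the chamber would increase this inner product. *)
Lemma move_to_chamber x : exists2 p, p \in ico_group & in_chamber (isometry p *m x).
Proof.
pose rho := \sum_k ray k.
have [p Hp pmax] := @arg_maxP _ _ _ 1%g (mem ico_group)
  (fun p => dot rho (isometry p *m x)) (group1 _).
exists p => // k; rewrite leNgt; apply/negP => neg.
have Hq : (p * ico_gen k)%g \in ico_group by rewrite groupM ?ico_gen_group.
have := pmax _ Hq; rewrite isometryM ?ico_gen_group // isometry_gen -mulmxA mirrorE.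
have rho_gt0 : 0 < dot rho (root k).
  rewrite dotC dot_sumr (bigD1 k) //= big1 => [|l lk].
    by rewrite dot_root_ray eqxx mulr1 addr0 ray_height_gt0.
  by rewrite dot_root_ray eq_sym (negPf lk) mulr0.
rewrite dotBr dotZr => /=.
set a := dot (root k) _ in neg *; set b := dot rho (root k) in rho_gt0 *.
by move: (dot rho _) => c; rewrite leNgt => /negP; apply; nra.
Qed.

(** The chamber is acute. *)
Lemma chamber_ray_gt0 x k : in_chamber x -> x != 0 -> 0 < dot x (ray k).
Proof.
move=> Cx x0; rewrite (ray_coords x) dot_suml.
have ge0 l : 0 <= dot (root l) x / ray_height l.
  by rewrite divr_ge0 // ltW // ray_height_gt0.
have [l lx] : exists l, dot (root l) x != 0.
  apply/existsP; apply: contraNT x0 => /existsPn x0; rewrite (ray_coords x).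
  by rewrite big1 // => l _; have /negPn/eqP -> := x0 l; rewrite mul0r scale0r.
rewrite (bigD1 l) //= ltr_pwDl //.
  rewrite dotZl mulr_gt0 ?dot_ray_gt0 // divr_gt0 ?ray_height_gt0 //.
  by rewrite lt_neqAle eq_sym lx Cx.
by apply: sumr_ge0 => i _; rewrite dotZl mulr_ge0 // ltW // dot_ray_gt0.
Qed.

Lemma dot_rays_eq0 x : (forall k, dot x (ray k) = 0) -> x = 0.
Proof.
move=> x0; apply: dot_self_eq0; rewrite {2}(ray_coords x) dot_sumr big1 // => k _.
by rewrite dotZr x0 mulr0.
Qed.

(** An isometry fixing two rays fixes their plane pointwise, hence maps the
    normal line of this plane, spanned by the j-th root, to itself. *)
Lemma stab_two_rays p j : p \in ico_group ->
    (forall k, k != j -> isometry p *m ray k = ray k) ->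
  p = 1%g \/ p = ico_gen j.
Proof.
move=> Hp fix_rays; set A := isometry p.
have root_unit k : dot (root k) (root k) = 1.
  have phi2 := golden_sq.
  by rewrite /root; case: k => -[|[|[|//]]] lt /=; rewrite ?vec3Z dot_vec3; lra.
have rootE : root j = dot (root j) (root j) / ray_height j *: ray j +
   \sum_(k | k != j) (dot (root k) (root j) / ray_height k) *: ray k.
  by rewrite [LHS]ray_coords (bigD1 j).
have [c Ac] : exists c : R, A *m root j = c *: root j.
  exists (dot (root j) (A *m root j)); apply/eqP; rewrite -subr_eq0; apply/eqP.
  set d := _ - _.
  have d_ray k : k != j -> dot d (ray k) = 0.
    move=> kj; rewrite dotBl dotZl -{1}(fix_rays k kj) dot_isometry //.
    by rewrite dot_root_ray eq_sym (negPf kj) !mulr0 subrr.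
  have d_root : dot d (root j) = 0.
    by rewrite dotBl dotZl root_unit mulr1 dotC subrr.
  apply: dot_rays_eq0 => k; case: (eqVneq k j) => [->|]; last exact: d_ray.
  apply: (mulfI (x := 1 / ray_height j)).
    by rewrite div1r invr_neq0 // gt_eqF // ray_height_gt0.
  rewrite mulr0 -dotZr; move: d_root; rewrite {1}rootE dotDr.
  rewrite dot_sumr big1 ?addr0 => [|i ij]; last by rewrite dotZr d_ray // mulr0.
  by rewrite root_unit.
have agree B : B *m root j = A *m root j -> (forall k, k != j -> B *m ray k = ray k) ->
    A = B.
  move=> Bj Bk; have Bray k : A *m ray k = B *m ray k.
    case: (eqVneq k j) => [->|kj]; last by rewrite fix_rays ?Bk.
    have c0 : dot (root j) (root j) / ray_height j != 0.
      by rewrite root_unit div1r invr_neq0 // gt_eqF // ray_height_gt0.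
    apply: (scalerI c0); rewrite !scalemxAr; apply/esym; move: Bj.
    rewrite {1 2}rootE !mulmxDr.
    have -> : B *m (\sum_(i | i != j) (dot (root i) (root j) / ray_height i) *: ray i) =
              A *m (\sum_(i | i != j) (dot (root i) (root j) / ray_height i) *: ray i).
      rewrite !mulmx_sumr; apply: eq_bigr => i ij.
      by rewrite -!scalemxAr fix_rays ?Bk.
    exact: addIr.
  apply: mulmx_inj => x; rewrite (ray_coords x) !mulmx_sumr.
  by apply: eq_bigr => k _; rewrite -!scalemxAr Bray.
have : c * c = 1.
  have := dot_isometry (root j) (root j) Hp; rewrite -/A Ac dotZl dotZr root_unit.
  by rewrite mulr1.
move/eqP; rewrite -expr2 sqrf_eq1 => /orP[]/eqP cE; [left|right].
  apply: (isometry_inj) => //.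
  by rewrite isometry1; apply: agree => [|k _]; rewrite mul1mx // Ac cE scale1r.
apply: (isometry_inj) => //; first exact: ico_gen_group.
rewrite isometry_gen; apply: agree => [|k kj]; rewrite mirrorE.
  by rewrite Ac cE root_unit mulr1 scaleN1r scaler_nat mulr2n opprD addrA subrr add0r.
by rewrite dot_root_ray eq_sym (negPf kj) !mulr0 scale0r subr0.
Qed.

(** * Hulls of orbits and their faces *)

Definition segment_closed K :=
  forall a b (t : R), 0 <= t <= 1 -> K a -> K b -> K (t *: a + (1 - t) *: b).

Lemma convex_setP K : @convex_set R 'cV[R]_3 K <-> segment_closed K.
Proof.
split=> [cK a b t /andP[t0 t1] Ka Kb|sK a b t /set_mem Ka /set_mem Kb].
  by apply/set_mem; exact: (cK a b (Itv01 t0 t1) (mem_set Ka) (mem_set Kb)).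
by apply/mem_set/(sK a b t%:num) => //; rewrite ge0 le1.
Qed.

Definition orbit_hull S :=
  convex_hull [set x | exists A v, [/\ I_h R A, S v & x = A *m v]].

Lemma orbit_hull_segment S : segment_closed (orbit_hull S).
Proof.
move=> a b t t01 Pa Pb K [cK SK].
by have /convex_setP sK := cK; apply: sK => //; [apply: Pa|apply: Pb].
Qed.

Lemma orbit_hull_min S K : segment_closed K ->
    (forall p v, p \in ico_group -> S v -> K (isometry p *m v)) ->
  orbit_hull S `<=` K.
Proof.
move=> sK SK; apply: smallest_sub; first exact/convex_setP.
by move=> _ [A [v [/I_hP[p Hp ->] Sv ->]]]; apply: SK.
Qed.

Lemma orbit_hull_seed S p v : p \in ico_group -> S v -> orbit_hull S (isometry p *m v).
Proof.
move=> Hp Sv; apply: sub_gen_smallest; exists (isometry p), v; split => //.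
by apply/I_hP; exists p.
Qed.

Lemma orbit_hull_isometry S p x : p \in ico_group ->
  orbit_hull S x -> orbit_hull S (isometry p *m x).
Proof.
move=> Hp; suff sub : orbit_hull S `<=` [set x | orbit_hull S (isometry p *m x)].
  exact: sub.
apply: orbit_hull_min => [a b t t01 /= Pa Pb|q v Hq Sv /=].
  by rewrite mulmxDr -!scalemxAr; apply: orbit_hull_segment.
by rewrite mulmxA -isometryM //; apply: orbit_hull_seed => //; apply: groupM.
Qed.

Lemma segment_closed3 K a b c (r s t : R) : segment_closed K ->
    0 <= r -> 0 <= s -> 0 <= t -> r + s + t = 1 ->
  K a -> K b -> K c -> K (r *: a + s *: b + t *: c).
Proof.
move=> sK r0 s0 t0 rst Ka Kb Kc.
have [rs0|rs_neq0] := eqVneq (r + s) 0.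
  have -> : r = 0 by lra.
  have -> : s = 0 by lra.
  have -> : t = 1 by lra.
  by rewrite !scale0r !add0r scale1r.
have rs_gt0 : 0 < r + s by rewrite lt_neqAle eq_sym rs_neq0 addr_ge0.
have -> : r *: a + s *: b + t *: c =
    (r + s) *: ((r / (r + s)) *: a + (1 - r / (r + s)) *: b) + (1 - (r + s)) *: c.
  rewrite scalerDr !scalerA; congr (_ *: _ + _ *: _ + _ *: _); last by lra.
    by rewrite mulrC divfK.
  by rewrite mulrBr mulr1 mulrC divfK //; lra.
apply: (sK) => //; first by apply/andP; split; lra.
apply: sK => //; rewrite divr_ge0 ?(ltW rs_gt0) //= ler_pdivrMr // mul1r; lra.
Qed.

Definition affine_independent a b c :=
  forall s t : R, s *: (b - a) + t *: (c - a) = 0 -> s = 0 /\ t = 0.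

(** Since u is not zero on the plane through a, b and c, this plane misses the
    origin, so a, b and c span the space. *)
Lemma plane_orthogonal a b c u w (h : R) : affine_independent a b c -> h != 0 ->
    [/\ dot u a = h, dot u b = h & dot u c = h] ->
    [/\ dot w a = 0, dot w b = 0 & dot w c = 0] ->
  w = 0.
Proof.
move=> indep h0 [ua ub uc] [wa wb wc]; apply/eqP; apply/negPn/negP => w0.
pose rows := [:: a; b - a; c - a].
pose D : 'M[R]_3 := \matrix_(i < 3) (rows`_i)^T.
have combE (v : 'rV[R]_3) :
    (v *m D)^T = v 0 0 *: a + v 0 1 *: (b - a) + v 0 2%:R *: (c - a).
  rewrite mulmx_sum_row linear_sum /= !big_ord_recr big_ord0 /= add0r !linearZ /= !rowK /= !trmxK.
  by congr (v 0 _ *: _ + v 0 _ *: _ + v 0 _ *: _); apply: val_inj.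
have : \det D == 0.
  rewrite -det_tr; apply/det0P; exists w^T; first by rewrite trmx_eq0.
  rewrite -trmx_mul; apply: trmx_inj; rewrite trmxK trmx0; apply/row_matrixP => i.
  rewrite row_mul rowK row0; apply/matrixP => i' j'; rewrite !ord1 [RHS]mxE.
  rewrite -[LHS]/(dot _ _) dotC; case: i => -[|[|[|//]]] lt /=;
    by rewrite ?dotBr ?wa ?wb ?wc ?subrr.
case/det0P => v v0 /(congr1 trmx); rewrite combE trmx0 => comb.
have v00 : v 0 0 = 0.
  move/(congr1 (dot u)): comb; rewrite dot0r !dotDr !dotZr !dotBr ua ub uc subrr.
  by rewrite !mulr0 !addr0 => /eqP; rewrite mulf_eq0 (negPf h0) orbF => /eqP.
move: comb; rewrite v00 scale0r add0r => /indep[v01 v02].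
case/eqP: v0; apply/rowP => i; rewrite mxE.
by case: i => -[|[|[|//]]] lt;
  [rewrite -[RHS]v00|rewrite -[RHS]v01|rewrite -[RHS]v02]; congr (v 0 _); apply: val_inj.
Qed.

(** If the identity induced a reflection of F, all of F would lie on the axis. *)
Lemma face_not_fixed P (F : set 'cV[R]_3) : faces P F -> ~ induces_reflection 1%:M F.
Proof.
case=> u [h [_ _ _ [a [b [c [Fa Fb Fc indep]]]]]] [_ [p [q [_ _ _ refl]]]].
have on_axis x : F x -> exists t : R, x - p = t *: (q - p).
  move=> /refl; rewrite mul1mx /line_reflection; set t := _ / _ => e; exists t.
  have : 2%:R *: (x - (p + t *: (q - p))) = 0.
    have e2 : x + x = 2%:R *: (p + t *: (q - p)) by rewrite {2}e addrCA subrr addr0.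
    by rewrite scalerBr -e2 scaler_nat mulr2n subrr.
  move/eqP; rewrite scaler_eq0 pnatr_eq0 /= subr_eq0 => /eqP ->.
  by rewrite addrC addKr.
have [ta ea] := on_axis _ Fa; have [tb eb] := on_axis _ Fb; have [tc ec] := on_axis _ Fc.
have diff x tx : x - p = tx *: (q - p) -> x - a = (tx - ta) *: (q - p).
  by move=> ex; rewrite scalerBl -ex -ea opprB addrA subrK.
have [_ tba] : tc - ta = 0 /\ - (tb - ta) = 0.
  apply: indep; rewrite (diff _ _ eb) (diff _ _ ec) !scalerA -scalerDl.
  by rewrite mulNr mulrC subrr scale0r.
have [] : (1 : R) = 0 /\ (0 : R) = 0; last by move/eqP; rewrite oner_eq0.
apply: indep; rewrite (diff _ _ eb) scale0r addr0 scale1r.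
by rewrite -[tb - ta]opprK tba oppr0 scale0r.
Qed.

Definition facet_normal (coef : 'I_3 -> R) := \sum_k coef k *: ray k.

(** The data by which a plane is recognized as the plane of a face: it cuts the
    rays of the chamber at points of the hull, the corners, every seed is in the
    orbit of a corner, and its normal is a combination of the two rays on the
    j-th mirror. *)
Record chamber_facet (S : set 'cV[R]_3) (j : 'I_3) (coef m : 'I_3 -> R) (h : R) : Prop := {
  coef_wall : coef j = 0;
  coef_gt0 : forall k, k != j -> 0 < coef k;
  corner_gt0 : forall k, 0 < m k;
  corner_height : forall k, dot (facet_normal coef) (m k *: ray k) = h;
  seed_corner : forall v, S v ->
    exists p k, p \in ico_group /\ v = isometry p *m (m k *: ray k);
  hull_corner : forall k, orbit_hull S (m k *: ray k)
}.

Section ChamberFacet.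
Variables (S : set 'cV[R]_3) (j : 'I_3) (coef m : 'I_3 -> R) (h : R).
Hypothesis SF : chamber_facet S j coef m h.

Local Notation P := (orbit_hull S).
Local Notation normal := (facet_normal coef).
Local Notation corner k := (m k *: ray k).

Lemma coef_ge0 k : 0 <= coef k.
Proof. by case: (eqVneq k j) => [->|/(coef_gt0 SF)/ltW //]; rewrite (coef_wall SF). Qed.

Lemma normal_dominant p k : p \in ico_group ->
  dot normal (isometry p *m ray k) <= dot normal (ray k).
Proof.
move=> Hp; rewrite !dot_suml; apply: ler_sum => l _; rewrite !dotZl.
by rewrite ler_wpM2l ?coef_ge0 // ray_dominant.
Qed.

(** By dominance, the normal attains its maximum over the orbit of a corner at
    the corner itself. *)
Lemma normal_max x : P x -> dot normal x <= h.
Proof.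
apply: (orbit_hull_min (K := [set x | dot normal x <= h])) =>
    [a b t /andP[t0 t1] /= Ka Kb|p v Hp /=].
  rewrite dotDr !dotZr; nra.
move=> /(seed_corner SF)[q [k [Hq ->]]]; rewrite mulmxA -isometryM // -scalemxAr.
by rewrite dotZr -(corner_height SF k) dotZr ler_pM2l ?(corner_gt0 SF) // normal_dominant // groupM.
Qed.

Lemma normal_pos x : in_chamber x -> x != 0 -> 0 < dot normal x.
Proof.
move=> Cx x0; rewrite dot_suml.
have [k kj] : exists k, k != j.
  by exists (if j == 0 then 1 else 0); case: (eqVneq j 0) => [->|]; rewrite // eq_sym.
rewrite (bigD1 k) //= ltr_pwDl //.
  by rewrite dotZl mulr_gt0 ?(coef_gt0 SF) // dotC chamber_ray_gt0.
by apply: sumr_ge0 => i _; rewrite dotZl mulr_ge0 ?coef_ge0 // dotC ltW // chamber_ray_gt0.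
Qed.

Lemma facet_height_gt0 : 0 < h.
Proof.
rewrite -(corner_height SF 0) dotZr mulr_gt0 ?(corner_gt0 SF) //.
apply: normal_pos => [k|].
  by rewrite dot_root_ray mulr_ge0 ?ler0n // ltW // ray_height_gt0.
by apply: contraTneq (dot_ray_gt0 0 0) => ->; rewrite dot0r ltxx.
Qed.

(** In barycentric coordinates: the plane of the facet cuts the chamber in the
    triangle of the three corners. *)
Lemma chamber_slice x : in_chamber x -> dot normal x = h -> P x.
Proof.
move=> Cx hx; have h_neq0 := lt0r_neq0 facet_height_gt0.
pose t k := dot (root k) x / ray_height k / m k.
have xE : x = \sum_k t k *: corner k.
  rewrite {1}(ray_coords x); apply: eq_bigr => k _; rewrite scalerA divfK //.
  by rewrite lt0r_neq0 // (corner_gt0 SF).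
have t0 k : 0 <= t k by rewrite !divr_ge0 // ltW // ?ray_height_gt0 // (corner_gt0 SF).
have sum_t : \sum_k t k = 1.
  apply: (mulIf h_neq0); rewrite mul1r -{2}hx xE dot_sumr mulr_suml.
  by apply: eq_bigr => k _; rewrite [RHS]dotZr (corner_height SF).
move: sum_t; rewrite xE !big_ord_recr !big_ord0 /= !add0r => sum_t.
by apply: segment_closed3 sum_t _ _ _ => //; [apply: orbit_hull_segment|exact: (hull_corner SF)..].
Qed.

Definition facet := [set x | P x /\ dot normal x = h].

Lemma dot_isometryV p u x : p \in ico_group ->
  dot u (isometry p *m x) = dot (isometry p^-1%g *m u) x.
Proof. by move=> Hp; rewrite -{1}(isometryKV u Hp) dot_isometry. Qed.

(** Move u into the chamber; its inner product with a corner is then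
    positive. *)
Lemma support_height_gt0 u (t : R) : u != 0 -> (forall x, P x -> dot u x <= t) -> 0 < t.
Proof.
move=> u0 max_t; have [r Hr Cru] := move_to_chamber u.
have ru0 : isometry r *m u != 0.
  by apply: contraNneq u0 => e; rewrite -(isometryK u Hr) e mulmx0.
have Hv : r^-1%g \in ico_group by rewrite groupV.
apply: lt_le_trans (max_t _ (orbit_hull_isometry Hv (hull_corner SF 0))).
by rewrite dot_isometryV // invgK dotZr mulr_gt0 ?(corner_gt0 SF) // chamber_ray_gt0.
Qed.

(** Move the barycentre g of three independent points of the face into the
    chamber.  The multiple of g on the plane of the facet is in the hull, and as
    g lies on a supporting plane, this multiple is g.  The three points are then
    on the plane of the facet, which is the supporting plane of the moved face. *)
Lemma facesP (F : set 'cV[R]_3) : faces P F ->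
  exists2 p, p \in ico_group & F = mulmx (isometry p) @` facet.
Proof.
case=> u [t [u0 max_t FE [a [b [c [+ + + indep]]]]]]; rewrite FE.
move=> [Pa ua] [Pb ub] [Pc uc].
have t_gt0 := support_height_gt0 u0 max_t; have h_gt0 := facet_height_gt0.
have [t_neq0 h_neq0] := (lt0r_neq0 t_gt0, lt0r_neq0 h_gt0).
pose g := 3^-1 *: a + 3^-1 *: b + 3^-1 *: c.
have thirds : 3^-1 + 3^-1 + 3^-1 = 1 :> R by lra.
have Pg : P g by apply: segment_closed3 thirds _ _ _ => //; apply: orbit_hull_segment.
have ug : dot u g = t by rewrite !dotDr !dotZr ua ub uc; lra.
have [p Hp Cg] := move_to_chamber g.
have Hv : p^-1%g \in ico_group by rewrite groupV.
pose A := isometry p; pose B := isometry p^-1%g.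
have AP x : P x -> P (A *m x) by apply: orbit_hull_isometry.
have BP x : P x -> P (B *m x) by apply: orbit_hull_isometry.
have g0 : A *m g != 0.
  apply: contraNneq t_neq0 => e; rewrite -ug -(isometryK g Hp) -/A e mulmx0 dot0r.
  by [].
pose s := dot normal (A *m g).
have s_gt0 : 0 < s by apply: normal_pos.
have s_le : s <= h by apply: normal_max; apply: AP.
have s_ge : h <= s.
  have : P ((h / s) *: (A *m g)).
    apply: chamber_slice; last by rewrite dotZr -/s divfK // lt0r_neq0.
    by move=> k; rewrite dotZr mulr_ge0 // divr_ge0 // ltW.
  move/BP/max_t; rewrite -scalemxAr isometryK // dotZr ug.
  by rewrite ger_pMl // ler_pdivrMr // mul1r.
have sE : dot normal (A *m a) + dot normal (A *m b) + dot normal (A *m c) = 3 * h.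
  have : s = h by apply/le_anti/andP.
  by rewrite /s !mulmxDr -!scalemxAr !dotDr !dotZr; lra.
have na := normal_max (AP _ Pa); have nb := normal_max (AP _ Pb).
have nc := normal_max (AP _ Pc).
have wE : t *: (B *m normal) - h *: u = 0.
  apply: (plane_orthogonal indep t_neq0 (u := u)); first by [].
  by rewrite !dotBl !dotZl -!dot_isometryV // -/A ua ub uc; split; nra.
have uE x : h * dot u x = t * dot normal (A *m x).
  have := congr1 (fun v => dot v x) wE.
  rewrite dotBl !dotZl [dot 0 x]dotC dot0r -dot_isometryV // -/A.
  by move/eqP; rewrite subr_eq0 => /eqP.
exists p^-1%g => //; apply/seteqP; split=> x /=.
  move=> [Px ux]; exists (A *m x); last exact: isometryK.
  split; first exact: AP.
  by apply: (mulfI t_neq0); rewrite -uE ux mulrC.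
move=> [z [Pz nz] <-]; split; first exact: BP.
by apply: (mulfI h_neq0); rewrite uE isometryKV // nz mulrC.
Qed.

(** The corners of the facet are three affinely independent points. *)
Lemma facet_face p : p \in ico_group -> faces P (mulmx (isometry p) @` facet).
Proof.
move=> Hp; have Hv : p^-1%g \in ico_group by rewrite groupV.
have normal0 : isometry p *m normal != 0.
  apply/eqP => e; have := facet_height_gt0; rewrite -(corner_height SF 0).
  by rewrite -(dot_isometry _ _ Hp) e dotC dot0r ltxx.
exists (isometry p *m normal), h; split => //.
- move=> x Px; rewrite -(isometryKV x Hp) dot_isometry //.
  by apply: normal_max; apply: orbit_hull_isometry.
- apply/seteqP; split=> x /=.
    move=> [z [Pz nz] <-]; rewrite dot_isometry //.
    by split => //; apply: orbit_hull_isometry.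
  move=> [Px nx]; exists (isometry p^-1 *m x); last exact: isometryKV.
  split; first exact: orbit_hull_isometry.
  by rewrite dot_isometryV // invgK.
have corner_facet k : (mulmx (isometry p) @` facet) (isometry p *m corner k).
  by exists (corner k) => //; split; [apply: (hull_corner SF)|apply: (corner_height SF)].
exists (isometry p *m corner 0), (isometry p *m corner 1), (isometry p *m corner 2%:R).
split=> // s t; rewrite -!mulmxBr !scalemxAr -mulmxDr => /(congr1 (mulmx (isometry p^-1))).
rewrite isometryK // mulmx0 => e.
have coord k :
    dot (root k) (s *: (corner 1 - corner 0) + t *: (corner 2%:R - corner 0)) = 0.
  by rewrite e dot0r.
have := coord 1; have := coord 2%:R.
rewrite !dotDr !dotZr !dotBr !dotZr !dot_root_ray /= !mulr1n !mulr0n.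
rewrite !mulr1 !mulr0 !subr0 !mulr0 add0r addr0.
have pos k : m k != 0 by rewrite lt0r_neq0 // (corner_gt0 SF).
move=> /eqP; rewrite mulf_eq0 (negPf (pos _)) orbF => /eqP ->.
by move=> /eqP; rewrite mulf_eq0 (negPf (pos _)) orbF => /eqP ->.
Qed.

(** An isometry A that preserves the facet fixes its normal n.  Then n . A n
    equals n . n, so each of the dominance inequalities between the rays
    occurring in n is an equality, and A fixes these rays. *)
Lemma facet_stab p : p \in ico_group ->
  mulmx (isometry p) @` facet = facet <-> p = 1%g \/ p = ico_gen j.
Proof.
move=> Hp; have Hv : p^-1%g \in ico_group by rewrite groupV.
split=> [stab|].
  have An : isometry p *m normal = normal.
    rewrite -{1}(_ : isometry p^-1%g *m normal = normal) ?isometryKV //.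
    apply/eqP; rewrite -subr_eq0; apply/eqP/dot_rays_eq0 => k.
    apply: (mulfI (lt0r_neq0 (corner_gt0 SF k))); rewrite mulr0.
    rewrite -dotZr dotBl -dot_isometryV //.
    have [_ ->] : facet (isometry p *m corner k).
      rewrite -stab; exists (corner k) => //.
      by split; [apply: (hull_corner SF)|apply: (corner_height SF)].
    by rewrite (corner_height SF) subrr.
  apply: stab_two_rays => // k kj.
  (* The difference of n . n and n . A n, expanded in the rays. *)
  have defect l i :
      0 <= coef l * (coef i * (dot (ray l) (ray i) - dot (ray l) (isometry p *m ray i))).
    by rewrite !mulr_ge0 ?coef_ge0 // subr_ge0 ray_dominant.
  have : dot normal normal - dot normal (isometry p *m normal) = 0 by rewrite An subrr.
  have -> : dot normal normal - dot normal (isometry p *m normal) = \sum_l \sum_i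
      coef l * (coef i * (dot (ray l) (ray i) - dot (ray l) (isometry p *m ray i))).
    rewrite /facet_normal !dot_suml -sumrB; apply: eq_bigr => l _.
    rewrite mulmx_sumr !dot_sumr -sumrB; apply: eq_bigr => i _.
    by rewrite -scalemxAr !dotZl !dotZr -mulrBr -mulrBr.
  move=> /eqP; rewrite psumr_eq0 => [/allP/(_ k (mem_index_enum _))|l _]; last first.
    exact: sumr_ge0.
  rewrite /= psumr_eq0 => [/allP/(_ k (mem_index_enum _))|l _]; last exact: defect.
  have ck := lt0r_neq0 (coef_gt0 SF kj).
  rewrite /= !mulf_eq0 (negPf ck) /= subr_eq0 => /eqP ek.
  apply/eqP; rewrite -subr_eq0; apply/eqP/dot_self_eq0.
  by rewrite dotBl !dotBr dot_isometry // [dot (isometry p *m _) _]dotC -ek !subrr.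
case=> ->; first by rewrite isometry1; apply/seteqP; split=> [x [z Fz <-]|x Fx];
  [rewrite mul1mx|exists x; rewrite ?mul1mx].
have mirror_facet x : facet x -> facet (mirror j *m x).
  case=> Px nx; split.
    by rewrite -isometry_gen; apply: orbit_hull_isometry => //; apply: ico_gen_group.
  rewrite mirrorE dotBr nx dotZr [dot normal _]dotC dot_sumr big1 ?mulr0 ?subr0 // => k _.
  rewrite dotZr dot_root_ray; case: eqVneq => [<-|]; last by rewrite !mulr0.
  by rewrite (coef_wall SF) mul0r.
have mirrorK x : mirror j *m (mirror j *m x) = x.
  rewrite -isometry_gen; have := isometryKV x (ico_gen_group j).
  suff -> : (ico_gen j)^-1%g = ico_gen j by [].
  apply/eqP; rewrite eq_invg_mul; apply/eqP.
  by apply: (ico_gen_centralizer (k := j)) => //; apply: ico_gen_group.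
rewrite isometry_gen; apply/seteqP; split=> [_ [x Fx <-]|x Fx]; first exact: mirror_facet.
by exists (mirror j *m x) => //; apply: mirror_facet.
Qed.

End ChamberFacet.

(** * The three solids *)

Lemma golden_cube : phi * phi * phi = 2 * phi + 1.
Proof. by have := golden_sq => phi2; rewrite phi2; lra. Qed.

Definition same_orbit x y := exists2 p, p \in ico_group & y = isometry p *m x.

Lemma same_orbit_refl x : same_orbit x x.
Proof. by exists 1%g; rewrite ?isometry1 ?mul1mx. Qed.

Lemma same_orbit_sym x y : same_orbit x y -> same_orbit y x.
Proof. by move=> [p Hp ->]; exists p^-1%g; rewrite ?groupV ?isometryK. Qed.

Lemma same_orbit_mirror k x y : same_orbit (mirror k *m x) y -> same_orbit x y.
Proof.
move=> [p Hp ->]; exists (ico_gen k * p)%g; first by rewrite groupM ?ico_gen_group.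
by rewrite isometryM ?ico_gen_group // isometry_gen mulmxA.
Qed.

Lemma same_orbit_mirror0 (a b c : R) y :
  same_orbit (vec3 (- a) b c) y -> same_orbit (vec3 a b c) y.
Proof.
move=> o; apply: (@same_orbit_mirror 0); rewrite /mirror /= mat3_mul.
by move: o; congr (same_orbit (vec3 _ _ _) _); lra.
Qed.

Lemma same_orbit_mirror2 (a b c : R) y :
  same_orbit (vec3 a (- b) c) y -> same_orbit (vec3 a b c) y.
Proof.
move=> o; apply: (@same_orbit_mirror 2%:R); rewrite /mirror /= mat3_mul.
by move: o; congr (same_orbit (vec3 _ _ _) _); lra.
Qed.

Lemma same_orbit_mirror1 (a' b' c' a b c : R) y :
    2 * a' = (1 - phi) * a - phi * b - c ->
    2 * b' = b - phi * a + (1 - phi) * c ->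
    2 * c' = (1 - phi) * b - a + phi * c ->
  same_orbit (vec3 a' b' c') y -> same_orbit (vec3 a b c) y.
Proof.
move=> ea eb ec o; apply: (@same_orbit_mirror 1).
rewrite /mirror /= -scalemxAl mat3_mul vec3Z.
by move: o; congr (same_orbit (vec3 _ _ _) _); lra.
Qed.

Lemma same_orbit_scale (t : R) x y : same_orbit x y -> same_orbit (t *: x) (t *: y).
Proof. by move=> [p Hp ->]; exists p => //; rewrite scalemxAr. Qed.

Lemma five_fold_orbit : same_orbit (ray 2%:R) (vec3 0 1 phi).
Proof.
rewrite rayE /=; apply: same_orbit_mirror2; rewrite opprK; exact: same_orbit_refl.
Qed.

(** The arguments of [same_orbit_mirror1] below are the coordinates of the
    successive images on the way from a chamber ray to a seed. *)
Lemma three_fold_orbit : same_orbit ((2 - phi) *: ray 0) (vec3 1 1 1).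
Proof.
have phi2 := golden_sq; have phi3 := golden_cube; rewrite rayE /= vec3Z.
apply: same_orbit_mirror0; apply: (@same_orbit_mirror1 (-1) (-1) 1); try lra.
apply: same_orbit_mirror0; apply: same_orbit_mirror2; rewrite !opprK; exact: same_orbit_refl.
Qed.

Lemma two_fold_orbit : same_orbit ((phi - 1) / 2 *: ray 1) (vec3 1 0 0).
Proof.
have phi2 := golden_sq; have phi3 := golden_cube; rewrite rayE /= vec3Z.
apply: (@same_orbit_mirror1 (- 2^-1) ((1 - phi) / 2) (phi / 2)); try lra.
apply: same_orbit_mirror0.
apply: (@same_orbit_mirror1 ((1 - phi) / 2) (- phi / 2) 2^-1); try lra.
apply: same_orbit_mirror0; apply: same_orbit_mirror2.
apply: (@same_orbit_mirror1 (-1) 0 0); try lra.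
by apply: same_orbit_mirror0; rewrite opprK; exact: same_orbit_refl.
Qed.

Lemma orbit_hull_same_orbit S x v : same_orbit x v -> S v -> orbit_hull S x.
Proof. by move=> /same_orbit_sym[p Hp ->] Sv; apply: orbit_hull_seed. Qed.

Lemma orbit_hull_midpoint S k x : orbit_hull S x ->
  orbit_hull S (2^-1 *: (x + mirror k *m x)).
Proof.
move=> Px; have -> : 2^-1 *: (x + mirror k *m x) =
    2^-1 *: x + (1 - 2^-1) *: (mirror k *m x).
  by rewrite scalerDr; congr (_ + _ *: _); lra.
apply: orbit_hull_segment => //; first by apply/andP; split; lra.
by rewrite -isometry_gen; apply: orbit_hull_isometry => //; apply: ico_gen_group.
Qed.

Lemma golden_sqrt5 : Num.sqrt 5 = 2 * phi - 1.
Proof. by rewrite /golden; lra. Qed.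

(** The mirror through the middle of the face lying over the chamber.  It passes
    through the corners on the two other rays; for the first two solids the
    corner on the 2-fold axis is the midpoint of an edge of the face. *)
Definition wall (s : solid) : 'I_3 :=
  match s with
  | TriakisIcosahedron => 2%:R
  | PentakisDodecahedron => 0
  | DeltoidalHexecontahedron => 1
  end.

(** Solutions of the three linear equations that put the corners at the same
    height. *)
Definition normal_coef (s : solid) (k : 'I_3) : R :=
  match s with
  | TriakisIcosahedron => [:: 7 - 4 * phi; 3 * phi - 4; 0]
  | PentakisDodecahedron => [:: 0; phi - 1; phi - 1]
  | DeltoidalHexecontahedron => [:: 5 - 3 * phi; 0; 2 * phi - 3]
  end`_k.

Definition corner_scale (s : solid) (k : 'I_3) : R :=
  match s with
  | TriakisIcosahedron => [:: 2 - phi; (7 * phi - 6) / 10; (7 * phi - 6) / 5]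
  | PentakisDodecahedron => [:: 2 - phi; 2^-1; (3 * phi + 12) / 19]
  | DeltoidalHexecontahedron =>
      [:: (2 * phi + 3) / 11 * (2 - phi); (phi - 1) / 2; phi / 3]
  end`_k.

Definition facet_height (s : solid) : R :=
  match s with
  | TriakisIcosahedron => phi + 7
  | PentakisDodecahedron => 3 * phi
  | DeltoidalHexecontahedron => 1
  end.

Lemma triakis_scale : (7 * Num.sqrt 5 - 5) / 10 = (7 * phi - 6) / 5.
Proof. by rewrite golden_sqrt5; lra. Qed.

Lemma pentakis_scale : (3 * Num.sqrt 5 + 27) / 38 = (3 * phi + 12) / 19.
Proof. by rewrite golden_sqrt5; lra. Qed.

Lemma deltoidal_scale : (Num.sqrt 5 + 4) / 11 = (2 * phi + 3) / 11.
Proof. by rewrite golden_sqrt5; lra. Qed.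

Local Notation corner s k := (corner_scale s k *: ray k).

Lemma corner5 s : exists2 v, seeds R s v & same_orbit (corner s 2%:R) v.
Proof.
have seed5 (t : R) : same_orbit (t *: ray 2%:R) (t *: vec3 0 1 phi).
  exact/same_orbit_scale/five_fold_orbit.
case: s; rewrite /corner_scale /=.
- by exists (((7 * phi - 6) / 5) *: vec3 0 1 phi) => //; right; rewrite triakis_scale.
- by exists (((3 * phi + 12) / 19) *: vec3 0 1 phi) => //; right; rewrite pentakis_scale.
- by exists ((phi / 3) *: vec3 0 1 phi) => //; right.
Qed.

Lemma corner3 s : exists2 v, seeds R s v & same_orbit (corner s 0) v.
Proof.
case: s; rewrite /corner_scale /=.
- by exists (vec3 1 1 1); [left|apply: three_fold_orbit].
- by exists (vec3 1 1 1); [left|apply: three_fold_orbit].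
- exists (((2 * phi + 3) / 11) *: vec3 1 1 1).
    by left; right; rewrite deltoidal_scale.
  by rewrite -scalerA; apply/same_orbit_scale/three_fold_orbit.
Qed.

Lemma corner_in_hull s k : orbit_hull (seeds R s) (corner s k).
Proof.
have in_hull l : (exists2 v, seeds R s v & same_orbit (corner s l) v) ->
    orbit_hull (seeds R s) (corner s l).
  by move=> [v Sv o]; apply: orbit_hull_same_orbit o Sv.
have P5 := in_hull _ (corner5 s); have P3 := in_hull _ (corner3 s).
have kE : [\/ k = 0, k = 1 | k = 2%:R].
  by case: k => -[|[|[|//]]] lt; [apply: Or31|apply: Or32|apply: Or33]; apply: val_inj.
case: kE => -> //; case: s in_hull P5 P3 => in_hull P5 P3.
- have := orbit_hull_midpoint 2%:R P5; congr (orbit_hull _ _).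
  by rewrite !rayE /corner_scale /mirror /= !vec3Z mat3_mul vec3D vec3Z; congr vec3; lra.
- have := orbit_hull_midpoint 0 P3; congr (orbit_hull _ _).
  have phi2 := golden_sq.
  by rewrite !rayE /corner_scale /mirror /= !vec3Z mat3_mul vec3D vec3Z; congr vec3; lra.
- by apply: in_hull; exists (vec3 1 0 0); [left; left|apply: two_fold_orbit].
Qed.

Lemma seed_same_orbit s v : seeds R s v -> exists k, same_orbit (corner s k) v.
Proof.
case: s => /=.
- case=> ->; first by exists 0; apply: three_fold_orbit.
  exists 2%:R; rewrite triakis_scale; exact/same_orbit_scale/five_fold_orbit.
- case=> ->; first by exists 0; apply: three_fold_orbit.
  exists 2%:R; rewrite pentakis_scale; exact/same_orbit_scale/five_fold_orbit.
- case=> [[->|->]|->]; first by exists 1; apply: two_fold_orbit.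
    exists 0; rewrite deltoidal_scale /corner_scale /= -scalerA.
    exact/same_orbit_scale/three_fold_orbit.
  by exists 2%:R; apply/same_orbit_scale/five_fold_orbit.
Qed.

Lemma solid_chamber_facet s :
  chamber_facet (seeds R s) (wall s) (normal_coef s) (corner_scale s) (facet_height s).
Proof.
have phi2 := golden_sq; have /andP[phi_gt phi_lt] := golden_bounds.
split.
- by case: s.
- by case: s => -[[|[|[|//]]]] lt //= _; rewrite /normal_coef /=; lra.
- move=> k; case: s; rewrite /corner_scale /=.
  + by case: k => -[|[|[|//]]] lt /=; lra.
  + by case: k => -[|[|[|//]]] lt /=; lra.
  + case: k => -[|[|[|//]]] lt /=; last 2 [lra|lra].
    by rewrite mulr_gt0; lra.
- move=> k; rewrite /facet_normal !big_ord_recr big_ord0 /= add0r !rayE /=.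
  have phi3 := golden_cube.
  have phi4 : phi * phi * phi * phi = 3 * phi + 2 by rewrite phi3; lra.
  have phi5 : phi * phi * phi * phi * phi = 5 * phi + 3 by rewrite phi4; lra.
  rewrite /normal_coef /corner_scale /facet_height.
  by case: s; case: k => -[|[|[|//]]] lt /=; rewrite !vec3Z !vec3D dot_vec3; lra.
- by move=> v /seed_same_orbit[k [p Hp vE]]; exists p, k.
exact: corner_in_hull.
Qed.

(** * The action on faces and designs *)

Section FaceAction.
Variable s : solid.
Local Notation P := (polyhedron R s).
Local Notation Facet := (facet (seeds R s) (normal_coef s) (facet_height s)).

Lemma solid_facesP (F : set 'cV[R]_3) : faces P F ->
  exists2 p, p \in ico_group & F = mulmx (isometry p) @` Facet.
Proof. exact: (facesP (solid_chamber_facet s)). Qed.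

Lemma solid_face p : p \in ico_group -> faces P (mulmx (isometry p) @` Facet).
Proof. exact: (facet_face (solid_chamber_facet s)). Qed.

Lemma image_isometryM p q (K : set 'cV[R]_3) : p \in ico_group -> q \in ico_group ->
  mulmx (isometry (p * q)%g) @` K = mulmx (isometry q) @` (mulmx (isometry p) @` K).
Proof.
by move=> Hp Hq; rewrite image_comp isometryM //; apply: eq_imagel => x _ /=; rewrite mulmxA.
Qed.

Lemma image_isometry1 (K : set 'cV[R]_3) : mulmx (isometry 1%g) @` K = K.
Proof. by rewrite isometry1 (eq_imagel (f' := id)) ?image_id // => x _; rewrite mul1mx. Qed.

(** Outside the group, the face is left in place: [isometry p] is then a matrix
    that need not map faces to faces. *)
Lemma move_face_subproof p (F : faces P) :
  faces P (mulmx (isometry (if p \in ico_group then p else 1%g)) @` val F).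
Proof.
have [q Hq ->] := solid_facesP (set_valP F).
case: ifP => Hp; last by rewrite image_isometry1; apply: solid_face.
by rewrite -image_isometryM //; apply: solid_face; apply: groupM.
Qed.

Definition move_face (F : faces P) p : faces P := SigSub (mem_set (move_face_subproof p F)).

Lemma val_move_face F p : p \in ico_group ->
  val (move_face F p) = mulmx (isometry p) @` val F.
Proof. by rewrite /move_face /= => ->. Qed.

Lemma base_face_subproof : faces P Facet.
Proof. by have := solid_face (group1 ico_group); rewrite image_isometry1. Qed.

Definition base_face : faces P := SigSub (mem_set base_face_subproof).

Lemma face_rep_subproof (F : faces P) :
  exists p, p \in ico_group /\ F = move_face base_face p.
Proof.
have [p Hp FE] := solid_facesP (set_valP F); exists p; split => //.
by apply: val_inj; rewrite val_move_face.
Qed.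

Definition face_rep F := sval (cid (face_rep_subproof F)).

Lemma face_repK : cancel face_rep (move_face base_face).
Proof. by move=> F; rewrite /face_rep; case: cid => p []. Qed.

Lemma face_rep_in F : face_rep F \in ico_group.
Proof. by rewrite /face_rep; case: cid => p []. Qed.

(** The type of faces with a finite type structure, obtained by representing
    each face by a group element that carries the base face to it. *)
Definition face_type : finType := can_type face_repK.

Lemma move_face_is_action :
  is_action ico_group (move_face : face_type -> 'S_12 -> face_type).
Proof.
split=> [p F G|p q Hp Hq F].
  move/(congr1 val) => e; apply: val_inj; move: e => /=; case: ifP => Hp.
    move/(congr1 (fun K => mulmx (isometry p^-1%g) @` K)).
    by rewrite -!image_isometryM ?groupV // mulgV !image_isometry1.
  by rewrite !image_isometry1.
by apply: val_inj; rewrite !val_move_face ?groupM // image_isometryM.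
Qed.

Definition face_action := Action move_face_is_action.

Lemma transitive_faces (F G : face_type) : G \in orbit face_action ico_group F.
Proof.
pose p := ((face_rep F)^-1 * face_rep G)%g.
have Hp : p \in ico_group by rewrite groupM ?groupV ?face_rep_in.
apply/orbitP; exists p => //; apply: val_inj.
have rep (E : face_type) : val E = mulmx (isometry (face_rep E)) @` Facet.
  by rewrite -{1}(face_repK E) val_move_face ?face_rep_in.
rewrite /= Hp (rep F) (rep G) -image_isometryM ?face_rep_in //.
by rewrite /p mulKVg.
Qed.

Lemma face_stabilizer (F : face_type) p : p \in ico_group ->
  mulmx (isometry p) @` val F = val F <->
    p = 1%g \/ p = (ico_gen (wall s) ^ face_rep F)%g.
Proof.
move=> Hp; set q := face_rep F; have Hq : q \in ico_group := face_rep_in F.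
have -> : val F = mulmx (isometry q) @` Facet.
  by rewrite -{1}(face_repK F) val_move_face.
have Hr : (q * p * q^-1)%g \in ico_group by rewrite !groupM ?groupV.
have -> : mulmx (isometry p) @` (mulmx (isometry q) @` Facet) = mulmx (isometry q) @` Facet
    <-> mulmx (isometry (q * p * q^-1)%g) @` Facet = Facet.
  rewrite image_isometryM ?groupM ?groupV // image_isometryM //; split=> [->|e].
    by rewrite -image_isometryM ?groupV // mulgV image_isometry1.
  rewrite -[in RHS]e -!image_isometryM ?groupM ?groupV //.
  by rewrite mulgKV.
rewrite (facet_stab (solid_chamber_facet s) Hr).
have conjE (r : 'S_12) : (q * p * q^-1)%g = r <-> p = (r ^ q)%g.
  rewrite conjgE; split=> [<-|->]; first by rewrite !mulgA mulVg mul1g mulgKV.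
  by rewrite !mulgA mulgV mul1g mulgK.
by rewrite !conjE conj1g.
Qed.

Variables (T : finType) (D : tile_designs (I_h R) P T).

(** Outside the group, [tile_act] is unconstrained, but an action must be
    injective there too. *)
Definition move_tile (e : T * face_type) p : T * face_type :=
  if p \in ico_group then tile_act D (isometry p) e else e.

Lemma I_h_isometry p : p \in ico_group -> I_h R (isometry p).
Proof. by move=> Hp; apply/I_hP; exists p. Qed.

Lemma move_tile_is_action : is_action ico_group move_tile.
Proof.
have morph p q e : p \in ico_group -> q \in ico_group ->
    move_tile e (p * q)%g = move_tile (move_tile e p) q.
  move=> Hp Hq; rewrite /move_tile groupM // Hp Hq isometryM //.
  by rewrite tile_actM //; apply: I_h_isometry.
split=> [p e e'|p q Hp Hq e]; last exact: morph.
have [Hp|nHp] := boolP (p \in ico_group); last by rewrite /move_tile (negPf nHp).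
move/(congr1 (move_tile^~ p^-1%g)); rewrite -!morph ?groupV // mulgV.
by rewrite /move_tile group1 isometry1 !tile_act1.
Qed.

Definition tile_action := Action move_tile_is_action.

Lemma tile_action_over e p : p \in ico_group ->
  (tile_action e p).2 = face_action e.2 p.
Proof.
move=> Hp; apply: val_inj; rewrite /= /move_tile Hp; case: e => t F.
by rewrite tile_over //; apply: I_h_isometry.
Qed.

Lemma tiling_orbitP (tau tau' : tiling P T) :
  tiling_orbit D tau tau' <->
  graph_of ([ffun x : face_type => tau' x] : {ffun face_type -> T}) \in
    orbit tile_action^* ico_group (graph_of [ffun x : face_type => tau x]).
Proof.
have graphE (t : tiling P T) (e : T * face_type) :
    tiling_graph t e <->
    e \in graph_of ([ffun x : face_type => t x] : {ffun face_type -> T}).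
  rewrite in_graph ffunE; split=> [[F _ <-] //|/eqP te].
  by exists e.2 => //; rewrite te -surjective_pairing.
split=> [[A IA tauE]|/orbitP[p Hp]].
  move: IA tauE => /I_hP[p Hp ->] tauE; apply/orbitP; exists p => //.
  apply/setP => e; apply/imsetP/idP => [[e' /graphE te' ->]|/graphE].
    by apply/graphE; rewrite tauE; exists e' => //; rewrite /= /move_tile Hp.
  rewrite tauE => -[e' /graphE te' <-]; exists e' => //.
  by rewrite /= /move_tile Hp.
move=> /setP gE; exists (isometry p); first exact: I_h_isometry.
apply/seteqP; split=> [e /graphE|_ [e /graphE te <-]].
  by rewrite -gE => /imsetP[e' /graphE te' ->]; exists e' => //; rewrite /= /move_tile Hp.
by apply/graphE; rewrite -gE; apply/imsetP; exists e => //; rewrite /= /move_tile Hp.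
Qed.

End FaceAction.

End IcosahedralGeometry.

Theorem theorem15 (R : realType) (s : solid) (T : finType)
  (D : tile_designs (I_h R) (polyhedron R s) T)
  (F : faces (polyhedron R s)) (f : 'M[R]_3)
  (hf : I_h R f) (hfF : induces_reflection f (val F))
  (tid tf : nat) (htid : tid = #|T|) (htf : tf = fixed_tiles D f F) :
  exists N : nat,
    [/\ tiling_orbits D #= `I_N,
        N%:R = 120^-1 * (tid%:R ^+ 60 + 24 * tid%:R ^+ 12 + 20 * tid%:R ^+ 20
                 + 15 * tid%:R ^+ 30 + tid%:R ^+ 30 + 24 * tid%:R ^+ 6
                 + 20 * tid%:R ^+ 10 + 15 * tid%:R ^+ 28 * tf%:R ^+ 4) :> rat &
        N%:R = 120^-1 * (tid%:R ^+ 60 + 16 * tid%:R ^+ 30 + 20 * tid%:R ^+ 20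
                 + 24 * tid%:R ^+ 12 + 20 * tid%:R ^+ 10 + 24 * tid%:R ^+ 6
                 + 15 * tid%:R ^+ 28 * tf%:R ^+ 4) :> rat].
Proof.
have /I_hP[p Hp fE] := hf.
have p_neq1 : p != 1%g.
  apply/eqP => p1; apply: (face_not_fixed (set_valP F)).
  by move: hfF; rewrite fE p1 isometry1.
pose x0 : face_type R s := F; pose q := face_rep F.
have Hq : q \in ico_group by apply: face_rep_in.
have pE : p = (ico_gen (wall s) ^ q)%g.
  case: hfF; rewrite fE => /(face_stabilizer F Hp)[p1|//].
  by rewrite p1 eqxx in p_neq1.
have stab : ('C_(ico_group)[x0 | face_action R s])%g = [set 1%g; p]%SET.
  apply/setP => r; rewrite in_set2; apply/setIP/idP => [[Hr]|r1p].
    move/(astab1_inP _ _ Hr)/(congr1 val); rewrite val_move_face //.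
    by move/(face_stabilizer F Hr); rewrite -/q -pE => -[->|->]; rewrite eqxx ?orbT.
  have Hr : r \in ico_group by case/orP: r1p => /eqP -> //; apply: group1.
  split=> //; apply/(astab1_inP _ _ Hr)/val_inj; rewrite val_move_face //.
  by apply/(face_stabilizer F Hr); rewrite -/q -pE; case/orP: r1p => /eqP ->; [left|right].
have not_power r : r \in ico_group -> p \in <[r]>%g -> r = p.
  by rewrite pE; apply: reflection_not_power.
have over := @tile_action_over R s T D.
have trans := transitive_faces (R := R) (s := s) x0.
pose N := #|graph_orbits (tile_action D)|.
have n_faces : #|face_type R s| = 60%N.
  by have := card_stab2_faces trans stab p_neq1; rewrite card_ico_group; lia.
have n_class : #|(p ^: ico_group)%g| = 15%N by rewrite pE card_reflection_class.
have n_fixed : fixed_faces (face_action R s) p = 4%N.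
  by have := class_fixed_faces trans stab p_neq1; rewrite n_class n_faces; lia.
have tfE : #|[set t | tile_action D (t, x0) p == (t, x0)]%SET| = tf.
  rewrite htf /fixed_tiles; apply: eq_card => t; rewrite !finset.in_set.
  by rewrite /= /move_tile Hp fE; apply/eqP/asboolP.
have count : (N * 120 = tid ^ 60 + 16 * tid ^ 30 + 20 * tid ^ 20 + 24 * tid ^ 12
    + 20 * tid ^ 10 + 24 * tid ^ 6 + 15 * (tid ^ 28 * tf ^ 4))%N.
  have := card_tiling_orbits over trans stab p_neq1 not_power.
  rewrite card_ico_group n_faces n_class n_fixed tfE -htid pE => ->.
  by rewrite (sum_nonreflections (wall s) Hq (fun n => tid ^ (60 %/ n))%N).
have countQ : N%:R * 120 = tid%:R ^+ 60 + 16 * tid%:R ^+ 30 + 20 * tid%:R ^+ 20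
    + 24 * tid%:R ^+ 12 + 20 * tid%:R ^+ 10 + 24 * tid%:R ^+ 6
    + 15 * (tid%:R ^+ 28 * tf%:R ^+ 4) :> rat.
  by move/(congr1 (fun n => n%:R : rat)): count; rewrite !(natrD, natrX, natrM).
exists N; split.
- exact: (@card_function_orbits _ _ (face_type R s) T (tile_action D) _ (tiling_orbitP D)).
- have -> : N%:R = 120^-1 * (N%:R * 120) :> rat by lra.
  by rewrite countQ; congr (_ * _); ring.
- have -> : N%:R = 120^-1 * (N%:R * 120) :> rat by lra.
  by rewrite countQ; congr (_ * _); ring.
Qed.
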